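(* Let $d\ge 1$ be an integer, and consider the additive group $G=\mathbb{R}^d/\mathbb{Z}^d$ with the Euclidean metric and normalized Haar measure $\mu$. Let $X_1,X_2,\dots$ be i.i.d. $G$-valued random variables with distribution $\nu$, and set $S_k=X_1+\cdots+X_k$. Let $0<p\le 1$, and assume that $\sum_{k=1}^\infty W_p(\nu^{*k},\mu)<\infty$. Let $f:G\to\mathbb{R}$ be a $p$-H\''older function with $\int_G f\,\mathrm{d}\mu=0$, and let $0\le \sigma<\infty$ be the constant for which $$\frac{\sum_{k=1}^N f(S_k)}{\sqrt N}\overset{d}{\to}\mathcal{N}(0,\sigma^2)\quad (N\to\infty)\qquad\text{and}\qquad \limsup_{N\to\infty}\frac{\sum_{k=1}^N f(S_k)}{\sqrt{2N\log\log N}}=\sigma\ \text{ almost surely}.$$ Then $\sigma=0$ if and only if $f=0$.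
   Context: The Euclidean metric on $\mathbb{R}^d/\mathbb{Z}^d$ is $\|x-y\|_{\mathbb{R}^d/\mathbb{Z}^d}=\min_{m\in\mathbb{Z}^d}|x-y-m|$, where $|\cdot|$ is the Euclidean norm. $\nu^{*k}$ is the $k$-fold convolution of $\nu$. A function $f:G\to\mathbb{R}$ is $p$-H\''older if there is $K\ge 0$ with $|f(x)-f(y)|\le K\|x-y\|_{\mathbb{R}^d/\mathbb{Z}^d}^p$ for all $x,y$. For Borel probability measures $\nu_1,\nu_2$ on $G$, $W_p(\nu_1,\nu_2)=\inf_{\vartheta}\int_{G\times G}\|x-y\|_{\mathbb{R}^d/\mathbb{Z}^d}^p\,\mathrm{d}\vartheta(x,y)$, the infimum being over all Borel probability measures $\vartheta$ on $G\times G$ with marginals $\nu_1$ and $\nu_2$. Under the stated assumptions a constant $\sigma$, depending only on $f$ and $\nu$, with both limit relations exists. $\mathcal{N}(0,\sigma^2)$ is the normal distribution with mean $0$ and variance $\sigma^2$ (the constant $0$ if $\sigma=0$). *)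

(* Defs.v *)
From HB Require Import structures.
From mathcomp Require Import all_boot all_order all_algebra.
From mathcomp Require Import finmap generic_quotient ring_quotient.
From mathcomp Require Import all_classical all_reals all_analysis.
From mathcomp Require Import ring lra.

Set Implicit Arguments.
Unset Strict Implicit.
Unset Printing Implicit Defensive.

Import Order.TTheory GRing.Theory Num.Theory.
Import numFieldNormedType.Exports.

Local Open Scope classical_set_scope.
Local Open Scope ring_scope.
Local Open Scope quotient_scope.

Section euclidean_norm.
Context {R : realType} {d : nat}.
Implicit Types u v : 'rV[R]_d.

(* The norm [`|v|] that the library puts on ['rV[R]_d] is the sup norm. *)
Definition enorm v : R := Num.sqrt (\sum_i v 0 i ^+ 2).

Lemma enorm_ge0 v : 0 <= enorm v.
Proof. exact: sqrtr_ge0. Qed.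

Lemma enorm0 : enorm 0 = 0.
Proof. by rewrite /enorm big1 ?sqrtr0// => i _; rewrite mxE expr0n. Qed.

Lemma enormN v : enorm (- v) = enorm v.
Proof. by congr Num.sqrt; apply: eq_bigr => i _; rewrite mxE sqrrN. Qed.

Lemma enorm0_eq0 v : enorm v = 0 -> v = 0.
Proof.
move=> /eqP; rewrite sqrtr_eq0 => v0; apply/rowP => i; rewrite mxE.
have : \sum_i v 0 i ^+ 2 == 0.
  by rewrite eq_le v0/= sumr_ge0// => j _; exact: sqr_ge0.
rewrite psumr_eq0; last by move=> j _; exact: sqr_ge0.
by move=> /allP/(_ i); rewrite mem_index_enum sqrf_eq0 => /(_ isT)/eqP.
Qed.

Lemma ler_enormD u v : enorm (u + v) <= enorm u + enorm v.
Proof.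
set A := \sum_i u 0 i ^+ 2; set B := \sum_i v 0 i ^+ 2.
pose C := \sum_i u 0 i * v 0 i.
have A0 : 0 <= A by apply: sumr_ge0 => i _; exact: sqr_ge0.
have B0 : 0 <= B by apply: sumr_ge0 => i _; exact: sqr_ge0.
have uvE : \sum_i (u + v) 0 i ^+ 2 = A + B + C *+ 2.
  rewrite /A /B /C -sumrMnl -!big_split/=; apply: eq_bigr => i _.
  by rewrite mxE sqrrD addrAC.
have CAB : C ^+ 2 <= A * B.
  have [B00|Bn0] := eqVneq B 0.
    have v0 : v = 0 by apply: enorm0_eq0; rewrite /enorm -/B B00 sqrtr0.
    rewrite /C v0 big1; first by rewrite expr0n mulr_ge0.
    by move=> i _; rewrite mxE mulr0.
  have Bgt0 : 0 < B by rewrite lt0r Bn0.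
  have : 0 <= \sum_i (B * u 0 i - C * v 0 i) ^+ 2.
    by apply: sumr_ge0 => i _; exact: sqr_ge0.
  have -> : \sum_i (B * u 0 i - C * v 0 i) ^+ 2 = B * (A * B - C ^+ 2).
    transitivity (B ^+ 2 * A - (B * C *+ 2) * C + C ^+ 2 * B); last by ring.
    transitivity (\sum_i (B ^+ 2 * u 0 i ^+ 2
        - (B * C *+ 2) * (u 0 i * v 0 i) + C ^+ 2 * v 0 i ^+ 2)); last first.
      by rewrite big_split/= sumrB -!mulr_sumr.
    by apply: eq_bigr => i _; ring.
  by rewrite pmulr_rge0// subr_ge0.
rewrite /enorm uvE -/A -/B.
rewrite -(@ler_pXn2r _ 2)// ?nnegrE ?addr_ge0 ?sqrtr_ge0//.
rewrite sqr_sqrtr; last first.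
  by rewrite -uvE; apply: sumr_ge0 => i _; exact: sqr_ge0.
rewrite sqrrD !sqr_sqrtr// addrAC lerD2r lerD2l -sqrtrM// lerMn2r/=.
rewrite (le_trans (ler_norm _))// -sqrtr_sqr ler_wsqrtr//.
Qed.

Lemma enorm_le_norm v : enorm v <= d%:R * `|v|.
Proof.
apply: (@le_trans _ _ (\sum_(i < d) `|v 0 i|)); last first.
  have -> : d%:R * `|v| = \sum_(i < d) `|v|.
    by rewrite sumr_const card_ord mulr_natl.
  apply: ler_sum => i _; rewrite [leRHS]mx_normrE.
  by rewrite (le_bigmax _ (fun ij => `|v ij.1 ij.2|) (0, i)).
rewrite -[leRHS]ger0_norm ?sumr_ge0// -sqrtr_sqr ler_wsqrtr// expr2 mulr_suml.
apply: ler_sum => i _; rewrite (bigD1 i)//= mulrDr -expr2 real_normK ?num_real//.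
by rewrite lerDl mulr_ge0// sumr_ge0.
Qed.

End euclidean_norm.

Section torus.
Context (R : realType) (d : nat).
Implicit Types u v m : 'rV[R]_d.

Definition int_lattice : {pred 'rV[R]_d} := [pred m | m \is a mxOver Num.int].

Lemma int_lattice_zmod_closed : zmod_closed int_lattice.
Proof.
by split=> [|u v /mxOverP uZ /mxOverP vZ]; apply/mxOverP => i j;
  rewrite !mxE ?rpredB.
Qed.

HB.instance Definition _ :=
  GRing.isZmodClosed.Build 'rV[R]_d int_lattice int_lattice_zmod_closed.

Definition torus := Quotient.quot int_lattice.

HB.instance Definition _ := GRing.Zmodule.on torus.
HB.instance Definition _ := isPointed.Build torus 0.

Implicit Types x y z : torus.

Definition torus_pi v : torus := \pi_(Quotient.quot int_lattice) v.

(* The infimum is a minimum (torus_distP), and any representatives give the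
   same value (torus_dist_le, torus_dist_lift). *)
Definition torus_dist x y : R :=
  inf [set enorm (repr x - repr y - m) | m in [set` int_lattice]].

Lemma torus_pi_repr x : torus_pi (repr x) = x.
Proof. exact: reprK. Qed.

Lemma torus_piD u v : torus_pi (u + v) = torus_pi u + torus_pi v.
Proof. exact: (Quotient.pi_add int_lattice). Qed.

Lemma torus_pi_eq u v : (torus_pi u = torus_pi v) <-> u - v \in int_lattice.
Proof.
rewrite (Quotient.idealrBE int_lattice).
by split=> [uv|/eqP//]; apply/eqP.
Qed.

Lemma nearest_lattice v : exists2 m, m \in int_lattice &
  forall n, n \in int_lattice -> enorm (v - m) <= enorm (v - n).
Proof.
pose r (a : R) : R := (Num.floor (a + 2^-1))%:~R.
have rP a (k : R) : k \is a Num.int -> (a - r a) ^+ 2 <= (a - k) ^+ 2.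
  move=> /intrP[{}k ->]; have /andP[h1 h2] := floor_itv (a + 2^-1).
  rewrite intrD -/(r a) in h1 h2.
  have [->//|] := eqVneq k (Num.floor (a + 2^-1)).
  rewrite neq_lt => /orP[|]; rewrite -?ltz1D1 => kr.
    have : k%:~R + 1 <= r a by rewrite -[1]/(1%:~R) -intrD ler_int lezD1.
    by move=> ?; nra.
  have : r a + 1 <= k%:~R by rewrite -[1]/(1%:~R) -intrD ler_int lezD1.
  by move=> ?; nra.
exists (\row_i r (v 0 i)).
  by apply/mxOverP => i j; rewrite mxE /r intr_int.
move=> n /mxOverP nZ; rewrite ler_wsqrtr//; apply: ler_sum => i _.
by rewrite !mxE; exact: rP.
Qed.

Lemma torus_distP x y : exists2 m, m \in int_lattice &
  torus_dist x y = enorm (repr x - repr y - m).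
Proof.
have [m mZ mP] := nearest_lattice (repr x - repr y).
exists m => //; apply/eqP; rewrite eq_le; apply/andP; split.
  by apply: ge_inf; [exists 0 => _ [n _ <-]; exact: enorm_ge0|exists m].
apply: lb_le_inf; first by exists (enorm (repr x - repr y - m)), m.
by move=> _ [n nZ <-]; exact: mP.
Qed.

Lemma torus_dist_le u v : torus_dist (torus_pi u) (torus_pi v) <= enorm (u - v).
Proof.
set x := torus_pi u; set y := torus_pi v.
pose m := (repr x - u) - (repr y - v).
have -> : u - v = repr x - repr y - m.
  by rewrite /m; apply/rowP => i; rewrite !mxE; ring.
apply: ge_inf; first by exists 0 => _ [n _ <-]; exact: enorm_ge0.
by exists m => //; rewrite /= rpredB//; apply/torus_pi_eq; rewrite torus_pi_repr.
Qed.

Lemma torus_dist_lift u x : exists2 v, x = torus_pi v &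
  torus_dist (torus_pi u) x = enorm (u - v).
Proof.
have [m mZ ->] := torus_distP (torus_pi u) x.
exists (u - (repr (torus_pi u) - repr x - m)); last by rewrite subKr.
rewrite -{1}[x]torus_pi_repr; apply/torus_pi_eq.
have -> : repr x - (u - (repr (torus_pi u) - repr x - m)) =
    (repr (torus_pi u) - u) - m by apply/rowP => i; rewrite !mxE; ring.
by rewrite rpredB//; apply/torus_pi_eq; rewrite torus_pi_repr.
Qed.

Lemma torus_distxx x : torus_dist x x = 0.
Proof.
apply/eqP; rewrite eq_le -{1 2}[x]torus_pi_repr.
rewrite (le_trans (torus_dist_le _ _)) ?subrr ?enorm0//=.
by have [m _ ->] := torus_distP x x; exact: enorm_ge0.
Qed.

Lemma torus_dist_eq0 x y : torus_dist x y = 0 -> x = y.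
Proof.
rewrite -[x]torus_pi_repr; have [v -> ->] := torus_dist_lift (repr x) y.
by move=> /enorm0_eq0/eqP; rewrite subr_eq0 => /eqP ->.
Qed.

Lemma torus_dist_sym x y : torus_dist x y = torus_dist y x.
Proof.
suff le a b : torus_dist a b <= torus_dist b a by apply/eqP; rewrite eq_le !le.
rewrite -[b]torus_pi_repr; have [v -> ->] := torus_dist_lift (repr b) a.
by rewrite -enormN opprB; exact: torus_dist_le.
Qed.

Lemma torus_dist_triangle y x z :
  torus_dist x z <= torus_dist x y + torus_dist y z.
Proof.
rewrite -[x]torus_pi_repr; have [v -> ->] := torus_dist_lift (repr x) y.
have [w -> ->] := torus_dist_lift v z.
apply: (le_trans (torus_dist_le _ _)); apply: le_trans (ler_enormD _ _).
by rewrite addrA subrK.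
Qed.

HB.instance Definition _ := @isMetric.Build R torus torus_dist
  torus_distxx torus_dist_eq0 torus_dist_sym torus_dist_triangle.

Lemma torus_mdistE x y : mdist x y = torus_dist x y.
Proof. by []. Qed.

Lemma torus_pi_continuous : continuous torus_pi.
Proof.
move=> u; apply/(@cvg_ballP _ _ _ (nbhs u) (nbhs_filter u)) => e e0.
near=> v; rewrite ballEmdist/= torus_mdistE.
apply: (le_lt_trans (torus_dist_le _ _)).
apply: (le_lt_trans (enorm_le_norm _)).
apply: (@le_lt_trans _ _ (d.+1%:R * `|u - v|)).
  by rewrite ler_wpM2r// ler_nat.
rewrite mulrC -ltr_pdivlMr//.
by near: v; apply: cvgr_dist_lt => //; rewrite divr_gt0.
Unshelve. all: by end_near. Qed.

Lemma torus_compact : compact [set: torus].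
Proof.
pose C : set 'rV[R]_d := [set v | forall i, `[0, 1]%classic (v ord0 i)].
have cC : compact C.
  apply: (@rV_compact R d (fun=> `[0, 1]%classic)) => _.
  exact: segment_compact.
have -> : [set: torus] = torus_pi @` C.
  apply/seteqP; split=> // x _.
  pose m := \row_i ((Num.floor (repr x 0 i))%:~R : R).
  exists (repr x - m) => [i|/=].
    rewrite /= in_itv/= !mxE subr_ge0 floor_le/= lerBlDl.
    by rewrite (le_trans (ltW (floorD1_gt _)))// intrD.
  rewrite -[RHS]torus_pi_repr; apply/torus_pi_eq.
  rewrite addrAC subrr sub0r rpredN.
  by apply/mxOverP => i j; rewrite mxE intr_int.
apply: continuous_compact => //.
exact/continuous_subspaceT/torus_pi_continuous.
Qed.

HB.instance Definition _ :=
  Measurable.copy torus (g_sigma_algebraType (@open torus)).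

Lemma torus_open_measurable (U : set torus) : open U -> measurable U.
Proof. by move=> oU; exact: sub_sigma_algebra. Qed.

Lemma torus_distDr x y z : torus_dist (x + z) (y + z) <= torus_dist x y.
Proof.
rewrite -[x]torus_pi_repr; have [v -> ->] := torus_dist_lift (repr x) y.
rewrite -[z]torus_pi_repr -!torus_piD (le_trans (torus_dist_le _ _))//.
by rewrite opprD addrACA subrr addr0.
Qed.

Definition torus_add (z : torus * torus) : torus := z.1 + z.2.

Lemma torus_distD x y x' y' :
  torus_dist (x + y) (x' + y') <= torus_dist x x' + torus_dist y y'.
Proof.
apply: (le_trans (torus_dist_triangle (x' + y) _ _)).
apply: lerD; first exact: (torus_distDr x x' y).
by rewrite (addrC x' y) (addrC x' y'); exact: (torus_distDr y y' x').
Qed.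

(* Second countability of the torus makes addition measurable for the product
   sigma-algebra (which is the Borel sigma-algebra of the product). *)
Lemma measurable_torus_add :
  measurable_fun [set: torus * torus] torus_add.
Proof.
have mE : @measurable _ torus = <<s @open torus >> by [].
apply: (@measurability _ _ _ torus _ _ _ mE) => _ [U oU <-].
rewrite setTI.
have [B cB [Bo Bb]] := compact_second_countable torus_compact.
set V := _ @^-1` _.
pose D := B `*` B `&` [set bc | bc.1 `*` bc.2 `<=` V].
have VE : V = \bigcup_(bc in D) (bc.1 `*` bc.2).
  apply/seteqP; split=> [[x y] Vxy|z [bc [_ bcV] zbc]]; last exact: bcV.
  have /nbhs_ballP[e /= e0 eU] : nbhs (x + y) U by exact: open_nbhs_nbhs.
  have e20 : 0 < e / 2 by rewrite divr_gt0.
  have [b [Bb' bx] bU] := Bb x _ (nbhsx_ballx x _ e20).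
  have [c [Bc' cy] cU] := Bb y _ (nbhsx_ballx y _ e20).
  exists (b, c) => //; split=> // -[x' y'] [/= /bU xx' /cU yy'].
  apply: eU; move: xx' yy'; rewrite !ballEmdist/= !torus_mdistE => xx' yy'.
  rewrite [e]splitr; apply: le_lt_trans (ltrD xx' yy').
  exact: torus_distD.
have cD : countable D.
  by apply: sub_countable (countableX cB cB); apply: subset_card_le => ? [].
rewrite VE bigcup_set_type; apply: countable_bigcupT_measurable.
  by rewrite (eq_countable (card_setT _)).
move=> [bc /= /set_mem[[/Bo ob /Bo oc] _]].
by apply: measurableX; exact: torus_open_measurable.
Qed.

HB.instance Definition _ := @isMeasurableFun.Build _ _ _ _
  torus_add measurable_torus_add.

(* By uniqueness of Haar measure exactly one probability satisfies this. *)
Definition normalized_haar (mu : probability torus R) : Prop :=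
  forall x (A : set torus), measurable A -> mu (+%R x @^-1` A) = mu A.

Definition convolution (nu1 nu2 : probability torus R) : probability torus R :=
  distribution (nu1 \x nu2)%E torus_add.

Definition convolution_pow (nu : probability torus R) (k : nat) :
    probability torus R :=
  iter k (convolution nu) \d_(0 : torus).

Definition coupling (nu1 nu2 : probability torus R) :
    set (probability (torus * torus)%type R) :=
  [set theta | forall A : set torus, measurable A ->
    pushforward theta fst A = nu1 A /\ pushforward theta snd A = nu2 A].

(* For [0 < p <= 1] the cost [mdist x y `^ p] is itself a metric; no outer
   power [1 / p] is taken. *)
Definition wasserstein (p : R) (nu1 nu2 : probability torus R) : \bar R :=
  ereal_inf [set (\int[theta]_z (mdist z.1 z.2 `^ p)%:E)%E
            | theta in coupling nu1 nu2].

Definition holder (p : R) (f : torus -> R) : Prop :=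
  exists2 K : R, 0 <= K & forall x y, `|f x - f y| <= K * mdist x y `^ p.

End torus.

Section random_walk.
Context {R : realType} {disp : measure_display} {T : measurableType disp}.
Variable P : probability T R.

Definition mutually_independent {disp' : measure_display}
    {T' : measurableType disp'} (X : nat -> {RV P >-> T'}) : Prop :=
  forall (J : {fset nat}) (B : nat -> set T'), (forall j, measurable (B j)) ->
    P (\bigcap_(j in [set` J]) (X j @^-1` B j)) =
    (\prod_(j <- J) P (X j @^-1` B j))%E.

(* Weak convergence of the laws of [Y n] to [L]; meaningful when each [Y n] is
   measurable. *)
Definition cvg_in_distribution (Y : nat -> T -> R)
    (L : probability (measurableTypeR R) R) : Prop :=
  forall g : R -> R, continuous g -> (exists M : R, forall x, `|g x| <= M) ->
    (\int[P]_w (g (Y n w))%:E @[n --> \oo] --> \int[L]_x (g x)%:E)%E.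

Definition walk {d : nat} (X : nat -> {RV P >-> torus R d}) (k : nat) (w : T) :
    torus R d :=
  \sum_(i < k) X i w.

End random_walk.

(* [normal_prob m 0] is the uniform law on [[0, 1]], not the Dirac mass. *)
Definition centered_normal {R : realType} (sigma : R) :
    probability (measurableTypeR R) R :=
  if sigma == 0 then \d_(0 : measurableTypeR R) : probability _ R
  else normal_prob 0 sigma : probability _ R.

(* Main.v *)
Require Import Defs.
From mathcomp Require Import all_boot all_order all_algebra.
From mathcomp Require Import finmap.
From mathcomp Require Import all_classical all_reals all_analysis.
From mathcomp Require Import measurable_realfun ring lra.

Set Implicit Arguments.
Unset Strict Implicit.
Unset Printing Implicit Defensive.

Import Order.TTheory GRing.Theory Num.Theory.
Import numFieldNormedType.Exports.

Local Open Scope classical_set_scope.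
Local Open Scope ring_scope.

(** Why the theorem holds.

    If f = 0, every normalized sum is 0, and the law of the iterated logarithm,
    read at a single sample point, gives sigma = 0.

    Conversely let sigma = 0.  Write T phi x for the mean of phi (x + y) over
    one step y of law nu, so that T^k phi x is the mean of phi (x + y) over y
    of law nu^{*k}.  Since f is p-Hölder with Haar mean 0, coupling nu^{*k}
    with the translation invariant measure mu bounds |T^k f| by a constant
    times W_p (nu^{*k}, mu) (iter_average_dist).  These bounds are summable,
    hence h = sum_{k >= 0} T^k f converges uniformly; it solves the Poisson
    equation T h = h - f, and T^n h tends to 0 uniformly (poisson_equation).

    With S_k the walk, the sum of f (S_k) over 1 <= k <= N equals the
    martingale M_N with increments h (S_{k+1}) - T h (S_k), up to a bounded
    term (birkhoff_sum_martingale).  Let V x be the variance of h (x + y) under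
    a step y.  Then the second moment of M_N is the sum of the means of V (S_k)
    for k < N, and these means converge to the Haar integral v of V
    (second_moment, iter_average_cvg).  The fourth moment of M_N is at most a
    constant times N^2 (fourth_moment_le).  If v were positive, M_N / sqrt N
    would have second moments bounded below and fourth moments bounded above,
    and could not converge in law to 0 (cvg_dirac_second_moment).  As sigma = 0
    says that it does, v = 0 (variance_eq0).

    So h (x + y) = T h x for almost every (x, y), and by Fubini there is a
    single y0 for which this holds for almost every x; by continuity of h and
    full support of mu it holds for all x (zero_variance_translation).  Thus T
    acts on h as a translation, T^n h x = h (x + n y0).  A translation keeps
    the supremum of |h|, whereas T^n h tends to 0 uniformly: h = 0, and
    f = h - T h = 0 (deterministic_average_eq0). *)

(** * Expectations of bounded measurable functions *)

(** On a probability space such functions form an algebra of integrable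
    functions, so linearity and Fubini need no integrability hypotheses. *)
Definition bounded_mfun {R : realType} {disp : measure_display}
    {T : measurableType disp} (f : T -> R) :=
  measurable_fun setT f /\ exists M, forall x, `|f x| <= M.

Section bounded_measurable.
Context {R : realType} {disp : measure_display} {T : measurableType disp}.
Implicit Types f g : T -> R.

Lemma bounded_mfun_cst (c : R) : bounded_mfun (fun _ : T => c).
Proof. by split=> //; exists `|c|. Qed.

Lemma bounded_mfunD f g : bounded_mfun f -> bounded_mfun g ->
  bounded_mfun (fun x => f x + g x).
Proof.
move=> [mf [M fM]] [mg [N gN]]; split; first exact: measurable_funD.
by exists (M + N) => x; rewrite (le_trans (ler_normD _ _))// lerD.
Qed.

Lemma bounded_mfunM f g : bounded_mfun f -> bounded_mfun g ->
  bounded_mfun (fun x => f x * g x).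
Proof.
move=> [mf [M fM]] [mg [N gN]]; split; first exact: measurable_funM.
by exists (M * N) => x; rewrite normrM ler_pM.
Qed.

Lemma bounded_mfunZ c f : bounded_mfun f -> bounded_mfun (fun x => c * f x).
Proof. exact/bounded_mfunM/bounded_mfun_cst. Qed.

Lemma bounded_mfunB f g : bounded_mfun f -> bounded_mfun g ->
  bounded_mfun (fun x => f x - g x).
Proof.
move=> bf bg; have -> : (fun x => f x - g x) = (fun x => f x + -1 * g x).
  by apply/funext => x; rewrite mulN1r.
by apply: bounded_mfunD => //; exact: bounded_mfunZ.
Qed.

Lemma bounded_mfunX n f : bounded_mfun f -> bounded_mfun (fun x => f x ^+ n).
Proof.
move=> bf; elim: n => [|n IHn]; first exact: bounded_mfun_cst.
have -> : (fun x => f x ^+ n.+1) = (fun x => f x * f x ^+ n).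
  by apply/funext => x; rewrite exprS.
exact: bounded_mfunM.
Qed.

Lemma bounded_mfun_norm f : bounded_mfun f -> bounded_mfun (fun x => `|f x|).
Proof.
move=> [mf [M fM]]; split; first exact: measurableT_comp.
by exists M => x; rewrite normr_id.
Qed.

Lemma bounded_mfun_comp {disp' : measure_display} {T' : measurableType disp'}
    (F : T' -> R) (g : T -> T') :
  bounded_mfun F -> measurable_fun setT g -> bounded_mfun (fun x => F (g x)).
Proof.
move=> [mF [M FM]] mg; split; first exact: measurableT_comp.
by exists M => x.
Qed.

Variable m : probability T R.

Lemma bounded_mfun_integrable f :
  bounded_mfun f -> m.-integrable setT (EFin \o f).
Proof.
move=> [mf [M fM]]; apply: measurable_bounded_integrable => //.
  by rewrite -ge0_fin_numE// fin_num_measure.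
exists M; split; first by rewrite num_real.
by move=> N MN x _ /=; exact: le_trans (fM x) (ltW MN).
Qed.

Lemma Expect_cst c : \int[m]_x c = c.
Proof.
rewrite Rintegral_cst// [X in fine X](_ : _ = 1%E) ?mulr1//.
exact: probability_setT.
Qed.

Lemma ExpectD f g : bounded_mfun f -> bounded_mfun g ->
  \int[m]_x (f x + g x) = \int[m]_x f x + \int[m]_x g x.
Proof.
by move=> bf bg; rewrite RintegralD//; exact: bounded_mfun_integrable.
Qed.

Lemma ExpectB f g : bounded_mfun f -> bounded_mfun g ->
  \int[m]_x (f x - g x) = \int[m]_x f x - \int[m]_x g x.
Proof.
by move=> bf bg; rewrite RintegralB//; exact: bounded_mfun_integrable.
Qed.

Lemma ExpectZ c f : bounded_mfun f ->
  \int[m]_x (c * f x) = c * \int[m]_x f x.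
Proof. by move=> bf; rewrite RintegralZl//; exact: bounded_mfun_integrable. Qed.

Lemma le_Expect f g : bounded_mfun f -> bounded_mfun g ->
  (forall x, f x <= g x) -> \int[m]_x f x <= \int[m]_x g x.
Proof.
by move=> bf bg fg; apply: le_Rintegral => //; exact: bounded_mfun_integrable.
Qed.

Lemma norm_Expect_le f c : bounded_mfun f -> (forall x, `|f x| <= c) ->
  `|\int[m]_x f x| <= c.
Proof.
move=> bf fc; rewrite -[leRHS]Expect_cst.
apply: (le_trans (le_normr_Rintegral _ _)) => //.
  exact: bounded_mfun_integrable.
apply: le_Expect => //; last exact: bounded_mfun_cst.
exact: bounded_mfun_norm.
Qed.

Lemma bounded_EFin_Expect f : bounded_mfun f ->
  (\int[m]_x (f x)%:E = (\int[m]_x f x)%:E)%E.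
Proof.
move=> bf; rewrite fineK//; apply: integrable_fin_num => //.
exact: bounded_mfun_integrable.
Qed.

End bounded_measurable.

Section product.
Context {R : realType} {d1 d2 : measure_display}.
Context {T1 : measurableType d1} {T2 : measurableType d2}.
Variables (m1 : probability T1 R) (m2 : probability T2 R).

(** Only the sections have to be bounded: a power of the real coordinate of the
    walk's state is unbounded on the state space but has a bounded law. *)
Lemma Expect_prod (F : T1 * T2 -> R) :
  (m1 \x m2)%E.-integrable setT (EFin \o F) ->
  (forall x, bounded_mfun (fun y => F (x, y))) ->
  \int[(m1 \x m2)%E]_z F z = \int[m1]_x \int[m2]_y F (x, y).
Proof.
move=> iF bF; rewrite /Rintegral -(integral12_prod_meas1 iF).
congr fine; apply: eq_integral => x _; rewrite /fubini_F /=.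
exact: (bounded_EFin_Expect _ (bF x)).
Qed.

Lemma bounded_mfun_section1 (F : T1 * T2 -> R) : bounded_mfun F ->
  forall x, bounded_mfun (fun y => F (x, y)).
Proof. by move=> bF x; exact: bounded_mfun_comp. Qed.

Lemma bounded_mfun_section2 (F : T1 * T2 -> R) : bounded_mfun F ->
  forall y, bounded_mfun (fun x => F (x, y)).
Proof. by move=> bF y; exact: bounded_mfun_comp. Qed.

Lemma Expect_prod1 (F : T1 * T2 -> R) : bounded_mfun F ->
  \int[(m1 \x m2)%E]_z F z = \int[m1]_x \int[m2]_y F (x, y).
Proof.
move=> bF; apply: Expect_prod; last exact: bounded_mfun_section1.
exact: bounded_mfun_integrable.
Qed.

Lemma Expect_prod2 (F : T1 * T2 -> R) : bounded_mfun F ->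
  \int[(m1 \x m2)%E]_z F z = \int[m2]_y \int[m1]_x F (x, y).
Proof.
move=> bF; rewrite /Rintegral.
have iF : (m1 \x m2)%E.-integrable setT (EFin \o F).
  exact: bounded_mfun_integrable.
rewrite -(integral21_prod_meas1 iF).
congr fine; apply: eq_integral => y _; rewrite /fubini_G /=.
exact: (bounded_EFin_Expect _ (bounded_mfun_section2 bF y)).
Qed.

End product.

Lemma Expect_image {R : realType} {d1 d2 : measure_display}
    {T1 : measurableType d1} {T2 : measurableType d2}
    (m1 : probability T1 R) (m2 : probability T2 R) (g : T1 -> T2)
    (mg : measurable_fun setT g)
    (gE : forall A, measurable A -> m1 (g @^-1` A) = m2 A) (F : T2 -> R) :
  bounded_mfun F -> \int[m1]_x F (g x) = \int[m2]_y F y.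
Proof.
move=> bF; pose g' : {mfun T1 >-> T2} := mfun_Sub (mem_set mg).
congr fine.
rewrite [RHS](@eq_measure_integral _ _ _ _ (distribution m1 g')); last first.
  by move=> A mA _; symmetry; exact: gE.
rewrite integral_pushforward//.
  by apply/measurable_EFinP; case: bF.
exact: (bounded_mfun_integrable m1 (bounded_mfun_comp bF mg)).
Qed.

Lemma probability_ae_ex {R : realType} {disp : measure_display}
    {T : measurableType disp} (m : probability T R) (Q : T -> Prop) :
  {ae m, forall w, Q w} -> exists w, Q w.
Proof.
move=> [N [mN N0 hN]]; apply: contrapT => noQ.
have TN : [set: T] `<=` N by move=> w _; apply: hN => Qw; apply: noQ; exists w.
have : (m setT <= m N)%E by rewrite le_measure ?inE.
have -> : m setT = 1%E := probability_setT m.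
by rewrite [X in (_ <= X)%E]N0 lee_fin ler10.
Qed.

Lemma Expect_eq0_ae {R : realType} {disp : measure_display}
    {T : measurableType disp} (m : probability T R) (psi : T -> R) :
  bounded_mfun psi -> (forall y, 0 <= psi y) -> \int[m]_y psi y = 0 ->
  {ae m, forall y, psi y = 0}.
Proof.
move=> bpsi psi0 I0.
have : ae_eq m setT (EFin \o psi) (cst 0%E).
  apply/(ae_eq_integral_abs m measurableT).
    by apply/measurable_EFinP; case: bpsi.
  have := bounded_EFin_Expect m bpsi; rewrite I0 => E.
  apply: etrans E; apply: eq_integral => y _.
  by rewrite /= ger0_norm.
by apply: filterS => y /= /(_ I)[].
Qed.

Lemma bounded_mfun_Expect2 {R : realType} {d1 d2 : measure_display}
    {T1 : measurableType d1} {T2 : measurableType d2}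
    (m1 : probability T1 R) (m2 : probability T2 R) (F : T1 * T2 -> R) :
  bounded_mfun F -> bounded_mfun (fun y => \int[m1]_x F (x, y)).
Proof.
move=> bF; split.
  have iF : (m1 \x m2)%E.-integrable setT (EFin \o F).
    exact: bounded_mfun_integrable.
  apply: measurableT_comp (measurable_fubini_G iF).
  exact: fine_measurable.
have [_ [M hM]] := bF; exists M => y.
by apply: norm_Expect_le => //; exact: bounded_mfun_section2.
Qed.

(** * Independence along a recursion *)

(** A process driven by Y_{k+1} = G (Y_k, X_k) from a constant Y_0 depends on
    the steps before k only, so Y_k and X_k are independent.  Independence of
    the steps is given on finite intersections of events; the induction
    carries along an arbitrary such event on the steps from k on. *)
Section independent_steps.
Context {R : realType} {disp dE d' : measure_display}.
Context {T : measurableType disp} {E : measurableType dE}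
        {T' : measurableType d'}.
Variables (P : probability T R) (X : nat -> {RV P >-> T'}).
Hypothesis hindep : mutually_independent X.
Variables (G : E * T' -> E) (y0 : E) (Y : nat -> {RV P >-> E}).
Hypothesis Y0 : forall w, Y 0%N w = y0.
Hypothesis YS : forall k w, Y k.+1 w = G (Y k w, X k w).
Hypothesis mG : measurable_fun setT G.

Let future (J : {fset nat}) (B : nat -> set T') : set T :=
  \bigcap_(j in [set` J]) (X j @^-1` B j).

Let future0 B : future fset0 B = setT.
Proof. by rewrite /future set_fset0 bigcap_set0. Qed.

Let measurable_future J B : (forall j, measurable (B j)) ->
  measurable (future J B).
Proof.
move=> mB; apply: fin_bigcap_measurable; first exact: finite_fset.
by move=> j _; rewrite -[X in measurable X]setTI; exact: measurable_funPT.
Qed.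

Let past_indep_future k := forall (J : {fset nat}) (B : nat -> set T') A,
  (forall j, measurable (B j)) -> (forall j, j \in J -> (k <= j)%N) ->
  measurable A ->
  P (Y k @^-1` A `&` future J B) = (P (Y k @^-1` A) * P (future J B))%E.

Let pair k w := (Y k w, X k w).

Let mpair k : measurable_fun setT (pair k).
Proof. exact: measurable_fun_pair. Qed.

(** The event on X_k joins the event on the later steps, which turns the claim
    into an instance of the induction hypothesis for J together with k. *)
Let rectangle k J B A C : past_indep_future k ->
  (forall j, measurable (B j)) -> (forall j, j \in J -> (k < j)%N) ->
  measurable A -> measurable C ->
  P (pair k @^-1` (A `*` C) `&` future J B) =
  (P (Y k @^-1` A) * P (X k @^-1` C) * P (future J B))%E.
Proof.
move=> IH mB Jk mA mC.
have kJ : k \notin J by apply/negP => /Jk; rewrite ltnn.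
pose B' j := if j == k then C else B j.
have mB' j : measurable (B' j) by rewrite /B'; case: ifP.
have BE j : j \in J -> B' j = B j.
  by rewrite /B'; case: eqP => // -> /(negP kJ).
have fE : future (k |` J)%fset B' = X k @^-1` C `&` future J B.
  rewrite /future; apply/seteqP; split=> w.
    move=> h; split.
      by have := h k; rewrite /B' eqxx; apply => /=; rewrite fset1U1.
    by move=> j /= jJ; rewrite -BE//; apply: h => /=; rewrite fset1Ur.
  move=> [wC h] j /= /fset1UP[->|jJ]; first by rewrite /B' eqxx.
  by rewrite BE//; exact: h.
have -> : pair k @^-1` (A `*` C) `&` future J B =
    Y k @^-1` A `&` future (k |` J)%fset B'.
  by rewrite fE setIA.
rewrite IH//; last by move=> j /fset1UP[->//|/Jk/ltnW].
rewrite -muleA; congr (_ * _)%E.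
rewrite /future hindep// big_fsetU1//= {1}/B' eqxx; congr (_ * _)%E.
rewrite hindep//; apply: eq_big_seq => j jJ; by rewrite BE.
Qed.

(** Conditioning on the event on the later steps gives a measure that agrees
    with the product of the two laws on rectangles, hence everywhere.  When
    the event is null there is no conditioning, but both sides vanish. *)
Let joint_law k J B C : past_indep_future k ->
  (forall j, measurable (B j)) -> (forall j, j \in J -> (k < j)%N) ->
  measurable C ->
  P (pair k @^-1` C `&` future J B) =
  ((distribution P (Y k) \x distribution P (X k)) C * P (future J B))%E.
Proof.
move=> IH mB Jk mC; set F := future J B.
have mF : measurable F by exact: measurable_future.
have mpC : measurable (pair k @^-1` C).
  by rewrite -[X in measurable X]setTI; exact: mpair.
have [PF0|PF0] := eqVneq (P F) 0%E.
  rewrite PF0 mule0; apply/eqP; rewrite eq_le measure_ge0 andbT -PF0.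
  by rewrite le_measure ?inE//; exact: measurableI.
have PFfin : P F \is a fin_num by exact: fin_num_measure.
have PFgt0 : 0 < fine (P F).
  by rewrite fine_gt0// lt0e PF0 measure_ge0 ltey_eq PFfin.
have q0 : 0 <= (fine (P F))^-1 by rewrite invr_ge0 ltW.
pose q : {nonneg R} := NngNum q0.
pose pk := pair k.
pose cond0 := mscale q (pushforward (mrestr P mF) pk).
pose cond := cond0 (mpair k).
have condE (D : set (E * T')) :
    cond D = ((fine (P F))^-1%:E * P (pair k @^-1` D `&` F))%E by [].
have PFV : ((fine (P F))^-1%:E * P F = 1)%E.
  by rewrite -(fineK PFfin) -EFinM /= mulVf// gt_eqF.
have prodE : forall D, measurable D ->
    (distribution P (Y k) \x distribution P (X k))%E D = cond D.
  apply: product_measure_unique => A C' mA mC'.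
  rewrite -[LHS]/(cond (A `*` C')) condE rectangle//.
  by rewrite muleCA PFV mule1.
by rewrite prodE// condE muleAC PFV mul1e.
Qed.

Let past_indep k : past_indep_future k.
Proof.
elim: k => [|k IH] J B A mB Jk mA.
  have [yA|yA] := pselect (A y0).
    have -> : Y 0%N @^-1` A = setT by apply/seteqP; split=> w //= _; rewrite Y0.
    by rewrite setTI probability_setT mul1e.
  have -> : Y 0%N @^-1` A = set0 by apply/seteqP; split=> w //=; rewrite Y0.
  by rewrite set0I measure0 mul0e.
have YE : Y k.+1 @^-1` A = pair k @^-1` (G @^-1` A).
  by apply/seteqP; split=> w /=; rewrite YS.
have mGA : measurable (G @^-1` A).
  by rewrite -[X in measurable X]setTI; exact: mG.
rewrite YE joint_law//; congr (_ * _)%E.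
have := @joint_law k fset0 B _ IH mB (fun _ => ltac:(by [])) mGA.
by rewrite !future0 setIT probability_setT mule1.
Qed.

Lemma law_state_step k (C : set (E * T')) : measurable C ->
  P ((fun w => (Y k w, X k w)) @^-1` C) =
  (distribution P (Y k) \x distribution P (X k))%E C.
Proof.
move=> mC.
have := @joint_law k fset0 (fun=> setT) _ (@past_indep k) (fun=> measurableT)
  (fun _ => ltac:(by [])) mC.
by rewrite !future0 setIT probability_setT mule1.
Qed.

Lemma Expect_state_step k (F : E * T' -> R) :
  bounded_mfun (fun w => F (Y k w, X k w)) -> measurable_fun setT F ->
  (forall y, bounded_mfun (fun x => F (y, x))) ->
  \int[P]_w F (Y k w, X k w) =
  \int[distribution P (Y k)]_y \int[distribution P (X k)]_x F (y, x).
Proof.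
move=> bF mF bFs.
pose pk : {mfun T >-> (E * T')%type} := mfun_Sub (mem_set (mpair k)).
have law C : measurable C -> distribution P pk C =
    (distribution P (Y k) \x distribution P (X k))%E C by exact: law_state_step.
have iP : P.-integrable setT ((EFin \o F) \o pk).
  exact: (bounded_mfun_integrable _ bF).
have mEF : measurable_fun setT (EFin \o F) by exact/measurable_EFinP.
have ipk : (distribution P pk).-integrable setT (EFin \o F).
  exact: integrable_pushforward.
have iF : (distribution P (Y k) \x distribution P (X k))%E.-integrable setT
    (EFin \o F).
  apply/integrableP; split=> //.
  have /integrableP[_] := ipk; apply: le_lt_trans.
  rewrite (@eq_measure_integral _ _ _ _ (distribution P pk))//.
  by move=> C mC _; symmetry; exact: law.
rewrite -Expect_prod//; congr fine.
rewrite [RHS](@eq_measure_integral _ _ _ _ (distribution P pk)); last first.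
  by move=> C mC _; symmetry; exact: law.
by rewrite integral_pushforward.
Qed.

End independent_steps.

(** * Functions on the torus and Haar measure *)

Section torus_functions.
Context {R : realType} {d : nat}.
Local Notation G := (torus R d).
Implicit Types (x y z : G) (phi psi : G -> R).

Lemma mdist_translate z x y : mdist (x + z) (y + z) = mdist x y :> R.
Proof.
apply/eqP; rewrite eq_le torus_distDr/=.
by rewrite -[in leLHS](addrK z x) -[in leLHS](addrK z y) torus_distDr.
Qed.

Lemma mdist_translatel z x y : mdist (z + x) (z + y) = mdist x y :> R.
Proof. by rewrite (addrC z x) (addrC z y) mdist_translate. Qed.

Lemma mdist_opp x y : mdist (- x) (- y) = mdist x y :> R.
Proof.
rewrite -(mdist_translate (x + y)) addKr addrCA addNr addr0.
exact: torus_dist_sym.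
Qed.

(** Translation invariance reduces measurability of the distance for the
    product sigma-algebra to that of a function of one variable. *)
Lemma mdist_sub x y : mdist x y = mdist (x - y) 0 :> R.
Proof. by rewrite -(mdist_translate (- y)) subrr. Qed.

Lemma torus_continuousP phi :
  (forall e, 0 < e -> exists2 del, 0 < del &
     forall x y, mdist x y < del -> `|phi x - phi y| < e) -> continuous phi.
Proof.
move=> h x; apply/(@cvgrPdist_lt _ _ _ (nbhs x) (nbhs_filter x)) => e e0.
have [del del0 hdel] := h e e0.
near=> y; apply: hdel.
have : ball x del y by near: y; exact: nbhsx_ballx.
by rewrite ballEmdist.
Unshelve. all: by end_near. Qed.

Lemma continuous_torus_measurable phi :
  continuous phi -> measurable_fun setT phi.
Proof.
move=> /continuousP cphi; apply: (measurability _ (RGenOpens.measurableE R)).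
move=> _ [_ [a [b ->] <-]]; rewrite setTI; apply: torus_open_measurable.
exact/cphi/interval_open.
Qed.

Lemma continuous_torus_bounded phi : continuous phi -> bounded_mfun phi.
Proof.
move=> cphi; split; first exact: continuous_torus_measurable.
have : compact (phi @` setT).
  apply: continuous_compact; last exact: torus_compact.
  exact: continuous_subspaceT.
move=> /compact_bounded[M [_ hM]]; exists (M + 1) => x.
by apply: hM; [rewrite ltrDl|exists x].
Qed.

Lemma measurable_torus_opp : measurable_fun setT (-%R : G -> G).
Proof.
have mE : @measurable _ G = <<s @open G >> by [].
apply: (@measurability _ _ _ G _ _ _ mE) => _ [U oU <-].
rewrite setTI; apply: torus_open_measurable.
suff /continuousP : continuous (-%R : G -> G) by exact.
move=> x; apply/(@cvg_ballP _ _ _ (nbhs x) (nbhs_filter x)) => e e0.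
near=> y; rewrite ballEmdist/= mdist_opp.
have : ball x e y by near: y; exact: nbhsx_ballx.
by rewrite ballEmdist.
Unshelve. all: by end_near. Qed.

Lemma torus_translate_continuous x : continuous (+%R x : G -> G).
Proof.
move=> y; apply/(@cvg_ballP _ _ _ (nbhs y) (nbhs_filter y)) => e e0.
near=> z; rewrite ballEmdist/=.
rewrite mdist_translatel.
have : ball y e z by near: z; exact: nbhsx_ballx.
by rewrite ballEmdist.
Unshelve. all: by end_near. Qed.

Lemma measurable_torus_translate x : measurable_fun setT (+%R x : G -> G).
Proof.
have : measurable_fun setT (fun y => torus_add (x, y)).
  apply: measurableT_comp; first exact: measurable_torus_add.
  exact: measurable_fun_pair.
by [].
Qed.

Lemma mdist0_continuous : continuous (fun x : G => mdist x 0 : R).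
Proof.
apply: torus_continuousP => e e0; exists e => // x y xy.
apply: le_lt_trans xy; rewrite ler_norml; apply/andP; split.
  rewrite lerNl opprB lerBlDr (torus_mdistE x y) torus_dist_sym.
  exact: torus_dist_triangle.
by rewrite lerBlDr; exact: torus_dist_triangle.
Qed.

Lemma measurable_mdist :
  measurable_fun setT (fun z : G * G => mdist z.1 z.2 : R).
Proof.
have -> : (fun z : G * G => mdist z.1 z.2 : R) =
    (fun x : G => mdist x 0 : R) \o (fun z : G * G => torus_add (z.1, - z.2)).
  by apply/funext => z /=; rewrite mdist_sub.
apply: (@measurableT_comp _ _ _ _ _ _ (fun x : G => mdist x 0 : R)).
  exact: continuous_torus_measurable mdist0_continuous.
apply: (measurableT_comp (@measurable_torus_add R d)).
apply: measurable_fun_pair; first exact: measurable_fst.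
exact: (measurableT_comp measurable_torus_opp measurable_snd).
Qed.

Lemma measurable_mdist_powR p :
  measurable_fun setT (fun z : G * G => mdist z.1 z.2 `^ p : R).
Proof.
apply: (@measurableT_comp _ _ _ _ _ _ (fun t : R => t `^ p)).
  exact: measurable_powR.
exact: measurable_mdist.
Qed.

End torus_functions.

Section haar.
Context {R : realType} {d : nat}.
Local Notation G := (torus R d).
Variable mu : probability (torus R d) R.
Hypothesis hmu : normalized_haar mu.

Lemma Expect_haar_translate x (phi : G -> R) : bounded_mfun phi ->
  \int[mu]_y phi (x + y) = \int[mu]_y phi y.
Proof.
exact: (Expect_image (@measurable_torus_translate R d x) (@hmu x)).
Qed.

(** Translates of a nonempty open set cover the torus, finitely many of them
    suffice by compactness, and all have the same measure, which is therefore
    not 0. *)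
Lemma haar_open_gt0 (U : set G) x0 : open U -> U x0 -> (0 < mu U)%E.
Proof.
move=> oU Ux0; rewrite lt0e measure_ge0 andbT; apply/negP => /eqP U0.
have oV x : open (+%R x @^-1` U).
  by have /continuousP := @torus_translate_continuous R d x; exact.
have cov : [set: G] `<=` \bigcup_(x in [set: G]) (+%R x @^-1` U).
  by move=> y _; exists (x0 - y) => //=; rewrite subrK.
have := @torus_compact R d; rewrite compact_cover.
move=> /(_ G setT (fun x => +%R x @^-1` U) (fun x _ => oV x) cov)[D _ Dcov].
have : mu.-negligible (\big[setU/set0]_(x <- D) (+%R x @^-1` U)).
  elim/big_ind : _ => [|A B nA nB|x _]; first exact: negligible_set0.
    exact: negligibleU.
  have mV : measurable (+%R x @^-1` U) by exact: torus_open_measurable.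
  apply/negligibleP => //; rewrite -U0.
  exact: (hmu x (torus_open_measurable oU)).
rewrite -(bigcup_seq D) => nD.
have nT : mu.-negligible [set: G].
  by apply: negligibleS nD => y /Dcov.
have mT0 : mu [set: G] = 0%E by apply/negligibleP.
have := probability_setT mu => /esym/eqP.
by have -> : mu setT = 0%E := mT0; rewrite onee_eq0.
Qed.

Lemma haar_Expect_eq0 (phi : G -> R) : continuous phi ->
  (forall x, 0 <= phi x) -> \int[mu]_x phi x = 0 -> forall x, phi x = 0.
Proof.
move=> cphi phi0 I0 x; apply/eqP; rewrite eq_le phi0 andbT leNgt.
apply/negP => phix.
have bphi : bounded_mfun phi by exact: continuous_torus_bounded.
pose U := phi @^-1` `]0, +oo[%classic.
have oU : open U.
  by move/continuousP : cphi; apply; exact: interval_open.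
have Ux : U x by rewrite /U/= in_itv/= andbT.
have := haar_open_gt0 oU Ux.
have [N [mN N0 hN]] := Expect_eq0_ae bphi phi0 I0.
have UN : U `<=` N.
  move=> y; rewrite /U/= in_itv/= andbT => py; apply: hN => /= pe.
  by move: py; rewrite pe ltxx.
rewrite ltNge => /negP; apply; rewrite -N0.
by rewrite le_measure ?inE//; exact: torus_open_measurable.
Qed.

End haar.

(** * Almost Hölder functions, Wasserstein distance and averaging *)

Section almost_holder.
Context {R : realType} {d : nat}.
Local Notation G := (torus R d).
Variable p : R.
Hypothesis p0 : 0 < p.
Implicit Types (x y z : G) (phi psi : G -> R).

(** The two-scale form of uniform continuity that the Wasserstein distance
    integrates against.  Unlike the Hölder condition it survives uniform
    limits, so it still holds for the solution h of the Poisson equation. *)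
Definition almost_holder phi := forall e, 0 < e -> exists2 C, 0 < C &
  forall x y, `|phi x - phi y| <= e + C * mdist x y `^ p.

Lemma almost_holder_continuous phi : almost_holder phi -> continuous phi.
Proof.
move=> hphi; apply: torus_continuousP => e e0.
have e20 : 0 < e / 2 by rewrite divr_gt0.
have [C C0 hC] := hphi _ e20.
pose a := e / 2 / C; have a0 : 0 < a by rewrite !divr_gt0.
exists (a `^ p^-1) => [|x y xy]; first exact: powR_gt0.
apply: (le_lt_trans (hC x y)).
rewrite [ltRHS]splitr ltrD2l mulrC -ltr_pdivlMr// -/a.
rewrite -[ltRHS](powRr1 (ltW a0)) -(mulVf (lt0r_neq0 p0)) powRrM.
by apply: gt0_ltr_powR; rewrite ?nnegrE ?mdist_ge0 ?powR_ge0.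
Qed.

Lemma almost_holder_bounded phi : almost_holder phi -> bounded_mfun phi.
Proof.
by move=> /almost_holder_continuous; exact: continuous_torus_bounded.
Qed.

Lemma holder_almost_holder phi : holder p phi -> almost_holder phi.
Proof.
move=> [K K0 hK] e e0; exists (K + 1); first by rewrite ltr_wpDl.
move=> x y; rewrite (le_trans (hK x y))// ler_wpDl ?(ltW e0)//.
by rewrite ler_wpM2r ?powR_ge0// lerDl.
Qed.

Lemma almost_holder_cst c : almost_holder (fun=> c).
Proof.
move=> e e0; exists 1 => // x y; rewrite subrr normr0.
by rewrite addr_ge0 ?(ltW e0)// mul1r powR_ge0.
Qed.

Lemma almost_holderD phi psi : almost_holder phi -> almost_holder psi ->
  almost_holder (fun x => phi x + psi x).
Proof.
move=> h1 h2 e e0; have e20 : 0 < e / 2 by rewrite divr_gt0.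
have [C C0 hC] := h1 _ e20; have [D D0 hD] := h2 _ e20.
exists (C + D) => [|x y]; first by rewrite addr_gt0.
rewrite opprD addrACA (le_trans (ler_normD _ _))//.
by rewrite (le_trans (lerD (hC x y) (hD x y)))// addrACA -splitr -mulrDl.
Qed.

Lemma almost_holderM phi psi : almost_holder phi -> almost_holder psi ->
  almost_holder (fun x => phi x * psi x).
Proof.
move=> h1 h2 e e0.
have [_ [M hM]] := almost_holder_bounded h1.
have [_ [N hN]] := almost_holder_bounded h2.
have M0 : 0 <= M by rewrite (le_trans _ (hM 0)).
have N0 : 0 <= N by rewrite (le_trans _ (hN 0)).
pose B := M + N + 1.
have B0 : 0 < B by rewrite ltr_wpDl// addr_ge0.
have eB : 0 < e / 2 / B by rewrite !divr_gt0.
have [C C0 hC] := h1 _ eB; have [D D0 hD] := h2 _ eB.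
exists (B * (C + D)) => [|x y]; first by rewrite mulr_gt0// addr_gt0.
have -> : phi x * psi x - phi y * psi y =
  (phi x - phi y) * psi x + phi y * (psi x - psi y) by ring.
rewrite (le_trans (ler_normD _ _))// !normrM.
set c := mdist x y `^ p; have c0 : 0 <= c by exact: powR_ge0.
apply: (@le_trans _ _ ((e / 2 / B + C * c) * B + B * (e / 2 / B + D * c))).
  apply: lerD; apply: ler_pM => //.
    by rewrite (le_trans (hN x))// /B; lra.
  by rewrite (le_trans (hM y))// /B; lra.
have Bn0 : B != 0 by rewrite gt_eqF.
have -> : (e / 2 / B + C * c) * B + B * (e / 2 / B + D * c) =
  e / 2 / B * B + e / 2 / B * B + B * (C + D) * c by ring.
by rewrite divfK// -splitr.
Qed.

Lemma almost_holderZ c phi : almost_holder phi ->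
  almost_holder (fun x => c * phi x).
Proof. exact/almost_holderM/almost_holder_cst. Qed.

Lemma almost_holderB phi psi : almost_holder phi -> almost_holder psi ->
  almost_holder (fun x => phi x - psi x).
Proof.
move=> h1 h2.
have -> : (fun x => phi x - psi x) = (fun x => phi x + -1 * psi x).
  by apply/funext => x; rewrite mulN1r.
by apply: almost_holderD => //; exact: almost_holderZ.
Qed.

Lemma almost_holder_sum n (u : nat -> G -> R) :
  (forall k, almost_holder (u k)) ->
  almost_holder (fun x => \sum_(0 <= k < n) u k x).
Proof.
move=> hu; elim: n => [|n IHn].
  under eq_fun do rewrite big_nil; exact: almost_holder_cst.
by under eq_fun do rewrite big_nat_recr//=; exact: almost_holderD.
Qed.

Lemma almost_holder_uniform_limit (u : nat -> G -> R) (r : nat -> R) phi :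
  (forall n, almost_holder (u n)) ->
  (forall n x, `|phi x - u n x| <= r n) -> r n @[n --> \oo] --> 0 ->
  almost_holder phi.
Proof.
move=> hu hr r0 e e0; have e30 : 0 < e / 3 by rewrite divr_gt0.
have /cvgrPdist_lt/(_ _ e30)[n _ /(_ n (leqnn n))] := r0.
rewrite sub0r normrN => rn.
have rne : r n <= e / 3 by rewrite ltW// (le_lt_trans (ler_norm _)).
have [C C0 hC] := hu n _ e30; exists C => // x y.
have -> : phi x - phi y = (phi x - u n x) + (u n x - u n y) - (phi y - u n y).
  by ring.
rewrite (le_trans (ler_normB _ _))//.
apply: (@le_trans _ _ (e / 3 + (e / 3 + C * mdist x y `^ p) + e / 3));
  last by lra.
apply: lerD; last by rewrite (le_trans (hr _ _)).
by rewrite (le_trans (ler_normD _ _))// lerD// (le_trans (hr _ _)).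
Qed.

Lemma almost_holder_translate x phi : almost_holder phi ->
  almost_holder (fun y => phi (x + y)).
Proof.
move=> h e e0; have [C C0 hC] := h _ e0; exists C => // y z.
by rewrite -(mdist_translatel x); exact: hC.
Qed.

Lemma bounded_mdist_powR :
  bounded_mfun (fun z : G * G => mdist z.1 z.2 `^ p : R).
Proof.
split; first exact: measurable_mdist_powR.
have [_ [M hM]] := continuous_torus_bounded (@mdist0_continuous R d).
exists (M `^ p) => z; rewrite ger0_norm ?powR_ge0//.
apply: ge0_ler_powR; rewrite ?nnegrE ?mdist_ge0 ?(ltW p0)//.
  by rewrite (le_trans _ (hM 0)).
by rewrite mdist_sub (le_trans (ler_norm _)).
Qed.

Lemma coupling_bound (m1 m2 : probability G R)
    (theta : probability (G * G)%type R) phi e C :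
  coupling m1 m2 theta -> bounded_mfun phi ->
  (forall x y, `|phi x - phi y| <= e + C * mdist x y `^ p) ->
  `|\int[m1]_x phi x - \int[m2]_x phi x| <=
     e + C * \int[theta]_z (mdist z.1 z.2 `^ p).
Proof.
move=> cpl bphi hC.
have b1 : bounded_mfun (fun z : G * G => phi z.1).
  exact: bounded_mfun_comp bphi measurable_fst.
have b2 : bounded_mfun (fun z : G * G => phi z.2).
  exact: bounded_mfun_comp bphi measurable_snd.
have bc := bounded_mdist_powR.
have bCc := bounded_mfunZ C bc.
rewrite -(Expect_image (m1 := theta) measurable_fst
  (fun A mA => (cpl A mA).1) bphi).
rewrite -(Expect_image (m1 := theta) measurable_snd
  (fun A mA => (cpl A mA).2) bphi).
rewrite -ExpectB//; have b12 := bounded_mfunB b1 b2.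
apply: (le_trans (le_normr_Rintegral _ _)) => //.
  exact: bounded_mfun_integrable.
apply: (@le_trans _ _ (\int[theta]_z (e + C * mdist z.1 z.2 `^ p))).
  apply: le_Expect => //; first exact: bounded_mfun_norm.
  by apply: bounded_mfunD => //; exact: bounded_mfun_cst.
rewrite ExpectD//; last exact: bounded_mfun_cst.
by rewrite Expect_cst ExpectZ.
Qed.

Lemma wasserstein_ge0 (m1 m2 : probability G R) : (0 <= wasserstein p m1 m2)%E.
Proof.
apply: le_ereal_inf_tmp => _ [theta _ <-]; apply: integral_ge0 => z _.
by rewrite lee_fin powR_ge0.
Qed.

Lemma wasserstein_bound (m1 m2 : probability G R) phi e C :
  (wasserstein p m1 m2 < +oo)%E -> bounded_mfun phi -> 0 < C ->
  (forall x y, `|phi x - phi y| <= e + C * mdist x y `^ p) ->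
  `|\int[m1]_x phi x - \int[m2]_x phi x| <= e + C * fine (wasserstein p m1 m2).
Proof.
move=> Wfin bphi C0 hC; set D := `|_|.
have Wnum : wasserstein p m1 m2 \is a fin_num.
  by rewrite ge0_fin_numE// wasserstein_ge0.
have : (((D - e) / C)%:E <= wasserstein p m1 m2)%E.
  apply: le_ereal_inf_tmp => _ [theta cpl <-].
  rewrite (bounded_EFin_Expect theta bounded_mdist_powR) lee_fin ler_pdivrMr//.
  by rewrite lerBlDl mulrC; exact: coupling_bound.
by rewrite -[X in (_ <= X)%E](fineK Wnum) lee_fin ler_pdivrMr// lerBlDl mulrC.
Qed.

End almost_holder.

Section averaging.
Context {R : realType} {d : nat}.
Local Notation G := (torus R d).
Variables (p : R) (nu : probability (torus R d) R).
Hypothesis p0 : 0 < p.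
Implicit Types (x y z : G) (phi psi : G -> R).

Definition average phi : G -> R := fun x => \int[nu]_y phi (x + y).

Local Notation "'T^' n" := (iter n average) (at level 1, format "'T^' n").

Let bounded_translate phi x : almost_holder p phi ->
  bounded_mfun (fun y => phi (x + y)).
Proof.
by move=> h; apply: (almost_holder_bounded p0); exact: almost_holder_translate.
Qed.

Lemma almost_holder_average phi : almost_holder p phi ->
  almost_holder p (average phi).
Proof.
move=> h e e0; have [C C0 hC] := h _ e0; exists C => // x y.
rewrite /average -ExpectB; [|exact: bounded_translate..].
apply: norm_Expect_le => [|z].
  by apply: bounded_mfunB; exact: bounded_translate.
by rewrite -(mdist_translate z); exact: hC.
Qed.

Lemma almost_holder_iter n phi :
  almost_holder p phi -> almost_holder p (T^n phi).
Proof. by move=> h; elim: n => //= n IHn; exact: almost_holder_average. Qed.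

Lemma Expect_convolution (m1 m2 : probability G R) phi : bounded_mfun phi ->
  \int[convolution m1 m2]_x phi x = \int[m2]_y \int[m1]_x phi (x + y).
Proof.
move=> bphi.
rewrite -(Expect_image (m1 := (m1 \x m2)%E)
  (m2 := convolution m1 m2) (@measurable_torus_add R d)
  (fun A _ => erefl) bphi).
exact: (Expect_prod2 m1 m2
  (bounded_mfun_comp bphi (@measurable_torus_add R d))).
Qed.

Lemma iter_averageE n phi x : almost_holder p phi ->
  T^n phi x = \int[convolution_pow nu n]_y phi (x + y).
Proof.
elim: n phi => [|n IHn] phi h.
  rewrite /= /Rintegral integral_dirac//; last first.
    by apply/measurable_EFinP; case: (bounded_translate x h).
  by rewrite diracT mul1e/= addr0.
rewrite iterSr IHn; last exact: almost_holder_average.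
rewrite [convolution_pow nu n.+1]/= Expect_convolution;
  last exact: bounded_translate.
apply: eq_Rintegral => y _; apply: eq_Rintegral => z _.
by rewrite -addrA (addrC y).
Qed.

Lemma averageB phi psi : almost_holder p phi -> almost_holder p psi ->
  average (fun x => phi x - psi x) = (fun x => average phi x - average psi x).
Proof.
by move=> h1 h2; apply/funext => x; rewrite /average ExpectB//;
  exact: bounded_translate.
Qed.

Lemma average_sum n (u : nat -> G -> R) : (forall k, almost_holder p (u k)) ->
  average (fun x => \sum_(0 <= k < n) u k x) =
  (fun x => \sum_(0 <= k < n) average (u k) x).
Proof.
move=> hu; apply/funext => x; rewrite /average; elim: n => [|n IHn].
  rewrite big_nil; under eq_Rintegral do rewrite big_nil.
  exact: Expect_cst.
rewrite big_nat_recr//= -IHn -ExpectD.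
- by apply: eq_Rintegral => y _; rewrite big_nat_recr.
- exact: (bounded_translate x (almost_holder_sum n hu)).
- exact: bounded_translate.
Qed.

Lemma average_dist phi psi r : almost_holder p phi -> almost_holder p psi ->
  (forall x, `|phi x - psi x| <= r) ->
  forall x, `|average phi x - average psi x| <= r.
Proof.
move=> h1 h2 hr x; rewrite /average -ExpectB; [|exact: bounded_translate..].
apply: norm_Expect_le => //.
by apply: bounded_mfunB; exact: bounded_translate.
Qed.

Variable mu : probability (torus R d) R.
Hypothesis hmu : normalized_haar mu.

(** Translation by x changes neither the modulus of continuity of phi nor its
    Haar integral, so the Wasserstein bound is uniform in x. *)
Lemma iter_average_dist n phi e C : almost_holder p phi ->
  (wasserstein p (convolution_pow nu n) mu < +oo)%E -> 0 < C ->
  (forall x y, `|phi x - phi y| <= e + C * mdist x y `^ p) ->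
  forall x, `|T^n phi x - \int[mu]_y phi y| <=
            e + C * fine (wasserstein p (convolution_pow nu n) mu).
Proof.
move=> h W0 C0 hC x; rewrite iter_averageE//.
rewrite -(Expect_haar_translate hmu x); last exact: almost_holder_bounded h.
apply: wasserstein_bound => //; first exact: bounded_translate.
by move=> y z; rewrite -(mdist_translatel x); exact: hC.
Qed.

End averaging.

(** * The Poisson equation *)

(** The Weierstrass M-test; the remainder r is the tail of the series b. *)
Lemma uniform_series {R : realType} {T : Type} (u : nat -> T -> R)
    (b : nat -> R) :
  (forall k x, `|u k x| <= b k) -> cvgn (series b) ->
  exists h : T -> R, exists2 r : nat -> R, r n @[n --> \oo] --> 0 &
    forall n x, `|h x - \sum_(0 <= k < n) u k x| <= r n.
Proof.
move=> ub cb.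
have b0 k (x : T) : 0 <= b k by rewrite (le_trans _ (ub k x)).
have cu (x : T) : cvgn (series (u ^~ x)).
  apply: normed_cvg; apply: series_le_cvg cb => k //=; exact: b0 k x.
exists (fun x => limn (series (u ^~ x))).
exists (fun n => limn (series b) - series b n).
  rewrite -(subrr (limn (series b))).
  by apply: cvgB; [exact: cvg_cst|exact: cb].
move=> n x.
have cn : (fun m => `|series (u ^~ x) m - series (u ^~ x) n|) @ \oo -->
    `|limn (series (u ^~ x)) - series (u ^~ x) n|.
  by apply: cvg_norm; apply: cvgB; [exact: cu|exact: cvg_cst].
rewrite -[X in `|_ - X|]/(series (u ^~ x) n).
have /cvg_lim <- // := cn; apply: limr_le.
  by apply/cvg_ex; eexists; exact: cn.
exists n => // m /= nm.
rewrite /series/= (big_cat_nat (leq0n n) nm)//= addrAC subrr add0r.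
apply: (le_trans (ler_norm_sum _ _ _)).
apply: (@le_trans _ _ (\sum_(n <= k < m) b k)); first exact: ler_sum.
rewrite lerBrDr addrC -(big_cat_nat (leq0n n) nm)//=.
apply: (@nondecreasing_cvgn_le _ (series b)) => //.
by apply: nondecreasing_series => k _ _; exact: b0.
Qed.

Section poisson.
Context {R : realType} {d : nat}.
Local Notation G := (torus R d).
Variables (p : R) (nu : probability (torus R d) R).
Hypothesis p0 : 0 < p.
Local Notation T := (average nu).

(** The solution is h = sum_k T^k f.  Applying T shifts the series, so
    T h = h - f, and T^n h is the n-th remainder of the series. *)
Lemma poisson_equation (f : G -> R) (b : nat -> R) : almost_holder p f ->
  (forall k x, `|iter k T f x| <= b k) -> cvgn (series b) ->
  exists h : G -> R, [/\ almost_holder p h,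
    (forall x, T h x = h x - f x) &
    exists2 r : nat -> R, r n @[n --> \oo] --> 0 &
      forall n x, `|iter n T h x| <= r n].
Proof.
move=> hf fb cb.
have [h [r r0 hr]] := uniform_series fb cb.
pose S n x := \sum_(0 <= k < n) iter k T f x.
have hS n : almost_holder p (S n).
  by apply: almost_holder_sum => k; exact: almost_holder_iter.
have hh : almost_holder p h by exact: almost_holder_uniform_limit hS hr r0.
have TS n x : T (S n) x = S n.+1 x - f x.
  rewrite /S (average_sum _ p0) => [|k]; last exact: almost_holder_iter.
  by rewrite big_nat_recl//= addrAC subrr add0r.
have Th x : T h x = h x - f x.
  apply/eqP; rewrite -subr_eq0 -normr_eq0 eq_le normr_ge0 andbT.
  have c0 : r n + r n.+1 @[n --> \oo] --> 0.
    rewrite -[X in _ --> X](addr0 0); apply: cvgD => //.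
    by rewrite -cvg_shiftS in r0.
  have /cvg_lim <- // := c0; apply: limr_ge; first by apply/cvg_ex; exists 0.
  apply: nearW => n.
  have -> : T h x - (h x - f x) = (T h x - T (S n) x) - (h x - S n.+1 x).
    by rewrite TS; ring.
  rewrite (le_trans (ler_normB _ _))//; apply: lerD; last exact: hr.
  exact: (average_dist nu p0 hh (hS n) (hr n)).
exists h; split; [exact: hh|exact: Th|exists r; first exact: r0].
move=> n x.
suff -> : iter n T h x = h x - S n x by exact: hr.
elim: n x => [|n IHn] x; first by rewrite /S big_nil subr0.
rewrite iterS (_ : iter n T h = fun x => h x - S n x); last exact/funext.
by rewrite (averageB _ p0)// TS Th opprB addrA subrK.
Qed.

Lemma average_shift (phi : G -> R) y0 x :
  T (fun z => phi (z + y0)) x = T phi (x + y0).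
Proof. by apply: eq_Rintegral => z _; rewrite addrAC. Qed.

(** Iterating the hypothesis gives T^n h z = h (z + n y0).  Evaluating at
    z = x - n y0 bounds |h x| by r n for every n. *)
Lemma deterministic_average_eq0 (h : G -> R) y0 (r : nat -> R) :
  (forall x, h (x + y0) = T h x) -> r n @[n --> \oo] --> 0 ->
  (forall n x, `|iter n T h x| <= r n) -> forall x, h x = 0.
Proof.
move=> hT r0 hr x.
have iterE n z : iter n T h z = h (z + y0 *+ n).
  elim: n z => [|n IHn] z; first by rewrite mulr0n addr0.
  rewrite iterS (_ : iter n T h = fun z => h (z + y0 *+ n)); last exact/funext.
  by rewrite average_shift -hT mulrSr addrA.
apply/eqP; rewrite -normr_eq0 eq_le normr_ge0 andbT.
have /cvg_lim <- // := r0; apply: limr_ge; first by apply/cvg_ex; exists 0.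
apply: nearW => n; have := hr n (x - y0 *+ n).
by rewrite iterE subrK.
Qed.

End poisson.

Lemma nneseries_partial_bound {R : realType} (w : nat -> \bar R) m :
  (forall k, (0 <= w k)%E) -> (\sum_(m <= k <oo) w k < +oo)%E ->
  (forall k, (m <= k)%N -> (w k < +oo)%E) /\
  exists B, forall n, \sum_(m <= k < n) fine (w k) <= B.
Proof.
move=> w0 Wfin.
have part n : (\sum_(m <= k < n) w k <= \sum_(m <= k <oo) w k)%E.
  exact: nneseries_lim_ge.
have wfin k : (m <= k)%N -> (w k < +oo)%E.
  move=> mk; apply: le_lt_trans Wfin; apply: le_trans (part k.+1).
  by rewrite big_nat_recr//= leeDr// sume_ge0.
split=> //; exists (fine (\sum_(m <= k <oo) w k)%E) => n.
rewrite -lee_fin fineK; last first.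
  by rewrite ge0_fin_numE//; exact: nneseries_ge0.
apply: le_trans (part n).
rewrite -sumEFin big_nat [leRHS]big_nat; apply: lee_sum => k /andP[mk _].
by rewrite fineK// ge0_fin_numE// wfin.
Qed.

Section decay.
Context {R : realType} {d : nat}.
Local Notation G := (torus R d).
Variables (p : R) (nu mu : probability (torus R d) R).
Hypotheses (p0 : 0 < p) (hmu : normalized_haar mu).
Hypothesis hW :
  (\sum_(1 <= k <oo) wasserstein p (convolution_pow nu k) mu < +oo)%E.
Local Notation T := (average nu).
Let W k := wasserstein p (convolution_pow nu k) mu.

Let W_summable : (forall k, (1 <= k)%N -> (W k < +oo)%E) /\
  exists B : R, forall n, \sum_(1 <= k < n) fine (W k) <= B.
Proof.
exact: (nneseries_partial_bound
  (fun k => wasserstein_ge0 p (convolution_pow nu k) mu) hW).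
Qed.

Lemma summable_iter_average (f : G -> R) : holder p f ->
  \int[mu]_x f x = 0 ->
  exists2 b : nat -> R, (forall k x, `|iter k T f x| <= b k) & cvgn (series b).
Proof.
move=> hf f0; have [K K0 hK] := hf.
have hf' : almost_holder p f by exact: holder_almost_holder.
have [_ [M hM]] := almost_holder_bounded p0 hf'.
have [Wfin [B hB]] := W_summable.
(* W_p of nu^{*0} is outside the summed range, so k = 0 uses a bound of f. *)
pose b k := if k is _.+1 then (K + 1) * fine (W k) else M.
have K1 : 0 < K + 1 by rewrite ltr_wpDl.
have b0 k : 0 <= b k.
  case: k => [|k] /=; first exact: le_trans (hM 0).
  by rewrite mulr_ge0 ?(ltW K1)// fine_ge0// wasserstein_ge0.
exists b => [[|k] x|].
- exact: hM.
- have := @iter_average_dist R d p nu p0 mu hmu k.+1 f 0 (K + 1)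
    hf' (Wfin k.+1 isT) K1.
  rewrite f0 add0r => /(_ _ x); rewrite subr0; apply=> y z.
  by rewrite add0r (le_trans (hK y z))// ler_wpM2r ?powR_ge0// lerDl.
apply: nondecreasing_is_cvgn.
  by apply: nondecreasing_series => k _ _.
exists (M + (K + 1) * B) => _ [n _ <-]; rewrite /series/=.
case: n => [|n]; last first.
  rewrite big_ltn//= lerD2l.
  rewrite (eq_big_nat _ _ (F2 := fun k => (K + 1) * fine (W k))).
    by rewrite -mulr_sumr ler_wpM2l// ltW.
  by case.
rewrite big_nil; apply: addr_ge0; first exact: (b0 0%N).
by rewrite mulr_ge0 ?(ltW K1)// (le_trans _ (hB 0%N))// big_geq.
Qed.

Lemma wasserstein_cvg0 : fine (W n) @[n --> \oo] --> 0.
Proof.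
have [_ [B hB]] := W_summable.
suff : cvgn (series (fun k => fine (W k))) by move/cvg_series_cvg_0.
apply: nondecreasing_is_cvgn.
  apply: nondecreasing_series => k _ _.
  by rewrite fine_ge0// wasserstein_ge0.
exists (fine (W 0%N) + B) => _ [[|n] _ <-]; rewrite /series/=.
  rewrite big_nil addr_ge0//; first by rewrite fine_ge0// wasserstein_ge0.
  by rewrite (le_trans _ (hB 0%N))// big_geq.
by rewrite big_ltn// lerD2l.
Qed.

Lemma iter_average_cvg (phi : G -> R) x : almost_holder p phi ->
  iter n T phi x @[n --> \oo] --> \int[mu]_y phi y.
Proof.
move=> h; apply/cvgrPdist_le => e e0.
have e20 : 0 < e / 2 by rewrite divr_gt0.
have [C C0 hC] := h _ e20.
have e2C : 0 < e / 2 / C by rewrite divr_gt0.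
have [Wfin _] := W_summable.
near=> n.
have n1 : (1 <= n)%N by near: n; exists 1%N.
rewrite distrC (le_trans (iter_average_dist p0 hmu h (Wfin _ n1) C0 hC x))//.
rewrite [leRHS]splitr lerD2l mulrC -ler_pdivlMr//.
rewrite (le_trans (ler_norm _))// -normrN -sub0r.
near: n; by have /cvgrPdist_le/(_ _ e2C) := wasserstein_cvg0.
Unshelve. all: by end_near. Qed.

End decay.

(** * Moments of the approximating martingale *)

Lemma measurable_walk {R : realType} {d : nat} {disp : measure_display}
    {Omega : measurableType disp} (P : probability Omega R)
    (X : nat -> {RV P >-> torus R d}) k : measurable_fun setT (walk X k).
Proof.
elim: k => [|k IHk].
  rewrite (_ : walk X 0 = fun=> 0); first exact: measurable_cst.
  by apply/funext => w; rewrite /walk big_ord0.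
rewrite (_ : walk X k.+1 = fun w => torus_add (walk X k w, X k w)).
  apply: (measurableT_comp (@measurable_torus_add R d)).
  exact: measurable_fun_pair.
by apply/funext => w; rewrite /walk big_ord_recr.
Qed.

Section martingale.
Context {R : realType} {d : nat}.
Local Notation G := (torus R d).
Context {disp : measure_display} {Omega : measurableType disp}.
Variables (P : probability Omega R) (X : nat -> {RV P >-> torus R d}).
Variable nu : probability (torus R d) R.
Hypothesis hindep : mutually_independent X.
Hypothesis hlaw : forall i (A : set (torus R d)), measurable A ->
  distribution P (X i) A = nu A.
Variables (p : R) (h : torus R d -> R).
Hypotheses (p0 : 0 < p) (hh : almost_holder p h).
Local Notation T := (average nu).

Definition increment (z : G * G) : R := h (z.1 + z.2) - T h z.1.

Definition step (z : (G * R) * G) : G * R :=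
  (torus_add (z.1.1, z.2), z.1.2 + increment (z.1.1, z.2)).

(** The pair of the walk and its martingale is the driven recursion to which
    independence of the past applies. *)
Fixpoint state k w : G * R :=
  if k is k'.+1 then step (state k' w, X k' w) else (0, 0).

Lemma state_walk k w : (state k w).1 = walk X k w.
Proof.
elim: k => [|k IHk]; first by rewrite /walk big_ord0.
by rewrite /= /torus_add/= IHk /walk big_ord_recr.
Qed.

Lemma bounded_increment : bounded_mfun increment.
Proof.
have bh : bounded_mfun h by exact: almost_holder_bounded hh.
apply: bounded_mfunB.
  exact: bounded_mfun_comp bh (@measurable_torus_add R d).
apply: bounded_mfun_comp; last exact: measurable_fst.
exact: (almost_holder_bounded p0 (almost_holder_average nu p0 hh)).
Qed.

Lemma measurable_step : measurable_fun setT step.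
Proof.
have mz : measurable_fun setT (fun z : (G * R) * G => (z.1.1, z.2)).
  apply: measurable_fun_pair; last exact: measurable_snd.
  exact: (measurableT_comp measurable_fst measurable_fst).
apply: measurable_fun_pair.
  exact: (measurableT_comp (@measurable_torus_add R d) mz).
apply: measurable_funD.
  exact: (measurableT_comp measurable_snd measurable_fst).
exact: (measurableT_comp bounded_increment.1 mz).
Qed.

Lemma measurable_state k : measurable_fun setT (state k).
Proof.
elim: k => [|k IHk]; first exact: measurable_cst.
apply: (measurableT_comp measurable_step).
by apply: measurable_fun_pair.
Qed.

Let Y k : {RV P >-> (G * R)%type} := mfun_Sub (mem_set (measurable_state k)).

Let Expect_law_state k (F : G * R -> R) : bounded_mfun F ->
  \int[distribution P (Y k)]_y F y = \int[P]_w F (state k w).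
Proof.
move=> bF; symmetry.
exact: (Expect_image (m2 := distribution P (Y k)) (measurable_state k)
  (fun _ _ => erefl) bF).
Qed.

Let Expect_step k (F : (G * R) * G -> R) :
  bounded_mfun (fun w => F (state k w, X k w)) -> measurable_fun setT F ->
  (forall y, bounded_mfun (fun x => F (y, x))) ->
  \int[P]_w F (state k w, X k w) =
  \int[distribution P (Y k)]_y \int[nu]_x F (y, x).
Proof.
move=> bF mF bFs.
rewrite (@Expect_state_step _ _ _ _ _ _ _ P X hindep step (0, 0) Y _ _
  measurable_step k F)//.
apply: eq_Rintegral => y _; congr fine; apply: eq_measure_integral => A mA _.
exact: hlaw.
Qed.

Definition martingale k w : R := (state k w).2.

Local Notation M := martingale.

Lemma martingaleS k w :
  M k.+1 w = M k w + increment (walk X k w, X k w).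
Proof. by rewrite -state_walk. Qed.

Let measurable_state1 k : measurable_fun setT (fun w => (state k w).1).
Proof. exact: (measurableT_comp measurable_fst (measurable_state k)). Qed.

Lemma bounded_martingale k : bounded_mfun (M k).
Proof.
split; first exact: (measurableT_comp measurable_snd (measurable_state k)).
have [_ [C hC]] := bounded_increment.
elim: k => [|k [B hB]]; first by exists 0 => w; rewrite /M/= normr0.
exists (B + C) => w; rewrite martingaleS.
by rewrite (le_trans (ler_normD _ _))// lerD.
Qed.

Let D k w := increment ((state k w).1, X k w).

Let MS k w : M k.+1 w = M k w + D k w. Proof. by []. Qed.

Let bounded_D k : bounded_mfun (D k).
Proof.
apply: bounded_mfun_comp bounded_increment _.
by apply: measurable_fun_pair => //; exact: measurable_state1.
Qed.

Lemma Expect_walk k (phi : G -> R) : almost_holder p phi ->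
  \int[P]_w phi (walk X k w) = iter k T phi 0.
Proof.
under eq_Rintegral do rewrite -state_walk.
elim: k phi => [|k IHk] phi hphi; first exact: (Expect_cst P (phi 0)).
have bphi := almost_holder_bounded p0 hphi.
have hT := almost_holder_average nu p0 hphi.
rewrite iterSr -IHk//.
have madd : measurable_fun setT (fun z : (G * R) * G => torus_add (z.1.1, z.2)).
  apply: (measurableT_comp (@measurable_torus_add R d)).
  apply: measurable_fun_pair; last exact: measurable_snd.
  exact: (measurableT_comp measurable_fst measurable_fst).
have mS1 : measurable_fun setT (fun w => torus_add ((state k w).1, X k w)).
  exact: (measurable_state1 k.+1).
have -> : \int[P]_w phi (state k.+1 w).1 =
    \int[distribution P (Y k)]_y \int[nu]_x phi (torus_add (y.1, x)).
  apply: (@Expect_step k (fun z => phi (torus_add (z.1.1, z.2)))).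
  - exact: bounded_mfun_comp bphi mS1.
  - exact: (measurableT_comp bphi.1 madd).
  - move=> y; apply: bounded_mfun_comp bphi _.
    exact: measurable_torus_translate.
apply: (@Expect_law_state k (fun y => T phi y.1)).
exact: bounded_mfun_comp (almost_holder_bounded p0 hT) measurable_fst.
Qed.

Definition conditional_variance (x : G) : R := \int[nu]_y increment (x, y) ^+ 2.

Let bounded_section x : bounded_mfun (fun y => increment (x, y)).
Proof. exact: bounded_mfun_section1 bounded_increment x. Qed.

Lemma Expect_increment x : \int[nu]_y increment (x, y) = 0.
Proof.
rewrite /increment/= ExpectB ?Expect_cst ?subrr//.
  exact: (almost_holder_bounded p0 (almost_holder_translate x hh)).
exact: bounded_mfun_cst.
Qed.

Lemma conditional_varianceE x :
  conditional_variance x = T (fun y => h y * h y) x - T h x * T h x.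
Proof.
have hx := almost_holder_bounded p0 (almost_holder_translate x hh).
rewrite /conditional_variance /increment/=.
transitivity (\int[nu]_y (h (x + y) * h (x + y) -
    (2 * T h x) * h (x + y) + T h x * T h x)).
  by apply: eq_Rintegral => y _; ring.
have bhh := bounded_mfunM hx hx.
have bZ := bounded_mfunZ (2 * T h x) hx.
rewrite ExpectD; [|exact: bounded_mfunB|exact: bounded_mfun_cst].
rewrite ExpectB// Expect_cst ExpectZ//.
have -> : \int[nu]_y h (x + y) = T h x by [].
have -> : \int[nu]_y (h (x + y) * h (x + y)) = T (fun y => h y * h y) x by [].
by ring.
Qed.

Lemma almost_holder_conditional_variance : almost_holder p conditional_variance.
Proof.
have -> : conditional_variance =
    (fun x => T (fun y => h y * h y) x - T h x * T h x).
  by apply/funext => x; exact: conditional_varianceE.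
have hT := almost_holder_average nu p0 hh.
apply: (almost_holderB p0); last exact: almost_holderM.
exact: (almost_holder_average nu p0 (almost_holderM p0 hh hh)).
Qed.

(** Given the state at time k the increment has mean 0. *)
Let martingale_orthogonal n k : \int[P]_w (M k w ^+ n * D k w) = 0.
Proof.
pose F (z : (G * R) * G) := z.1.2 ^+ n * increment (z.1.1, z.2).
have bF : bounded_mfun (fun w => F (state k w, X k w)).
  exact: bounded_mfunM (bounded_mfunX n (bounded_martingale k)) (bounded_D k).
have -> : \int[P]_w (M k w ^+ n * D k w) =
    \int[distribution P (Y k)]_y \int[nu]_x F (y, x).
  apply: (@Expect_step k F) => //.
    apply: measurable_funM.
      apply: measurable_funX.
      exact: (measurableT_comp measurable_snd measurable_fst).
    apply: (measurableT_comp bounded_increment.1).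
    apply: measurable_fun_pair; last exact: measurable_snd.
    exact: (measurableT_comp measurable_fst measurable_fst).
  by move=> y; exact: (bounded_mfunZ (y.2 ^+ n) (bounded_section y.1)).
rewrite -[RHS](Expect_cst (distribution P (Y k))); apply: eq_Rintegral => y _.
by rewrite /F/= ExpectZ ?Expect_increment ?mulr0//; exact: bounded_section.
Qed.

Let Expect_D2 k : \int[P]_w (D k w ^+ 2) = iter k T conditional_variance 0.
Proof.
pose F (z : (G * R) * G) := increment (z.1.1, z.2) ^+ 2.
have hV := almost_holder_conditional_variance.
have -> : \int[P]_w (D k w ^+ 2) =
    \int[distribution P (Y k)]_y \int[nu]_x F (y, x).
  apply: (@Expect_step k F).
  - exact: bounded_mfunX (bounded_D k).
  - apply: measurable_funX; apply: (measurableT_comp bounded_increment.1).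
    apply: measurable_fun_pair; last exact: measurable_snd.
    exact: (measurableT_comp measurable_fst measurable_fst).
  - by move=> y; exact: (bounded_mfunX 2 (bounded_section y.1)).
rewrite -Expect_walk//; under [RHS]eq_Rintegral do rewrite -state_walk.
apply: (@Expect_law_state k (fun y => conditional_variance y.1)).
exact: bounded_mfun_comp (almost_holder_bounded p0 hV) measurable_fst.
Qed.

Lemma second_moment k :
  \int[P]_w (M k w ^+ 2) = \sum_(0 <= i < k) iter i T conditional_variance 0.
Proof.
elim: k => [|k IHk].
  rewrite big_nil; under eq_Rintegral do rewrite /M/= expr0n.
  exact: Expect_cst.
rewrite big_nat_recr//= -IHk -Expect_D2.
have bMD :=
  bounded_mfunM (bounded_mfunX 1 (bounded_martingale k)) (bounded_D k).
have b2 := bounded_mfunX 2 (bounded_martingale k).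
have bD2 := bounded_mfunX 2 (bounded_D k).
transitivity (\int[P]_w (M k w ^+ 2 + 2 * (M k w ^+ 1 * D k w) + D k w ^+ 2)).
  by apply: eq_Rintegral => w _; rewrite MS; ring.
rewrite ExpectD//; last by apply: bounded_mfunD => //; exact: bounded_mfunZ.
rewrite ExpectD//; last exact: bounded_mfunZ.
by rewrite ExpectZ// martingale_orthogonal mulr0 addr0.
Qed.

Variable C : R.
Hypothesis hC : forall z, `|increment z| <= C.

Let C0 : 0 <= C. Proof. exact: le_trans (hC (0, 0)). Qed.

Lemma second_moment_le k : \int[P]_w (M k w ^+ 2) <= C ^+ 2 *+ k.
Proof.
elim: k => [|k IHk]; first by rewrite second_moment big_nil mulr0n.
rewrite second_moment big_nat_recr//= -second_moment mulrSr lerD//.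
rewrite -Expect_D2 -[leRHS](Expect_cst P).
apply: le_Expect; [exact: bounded_mfunX|exact: bounded_mfun_cst|move=> w].
by rewrite -real_normK ?num_real// lerXn2r ?nnegrE//; exact: hC.
Qed.

(** With m = M_k and e = D_k, in (m + e)^4 the term 4 m^3 e has mean 0, and
    4 m e^3 <= 2 m^2 e^2 + 2 e^4.  So the fourth moment grows by at most
    8 C^2 E m^2 + 3 C^4 <= 8 C^4 k + 3 C^4, which is below the growth
    4 C^4 ((k + 1)^2 - k^2) of the claimed bound. *)
Lemma fourth_moment_le k : \int[P]_w (M k w ^+ 4) <= 4 * C ^+ 4 * k%:R ^+ 2.
Proof.
elim: k => [|k IHk].
  under eq_Rintegral do rewrite /M/= expr0n.
  by rewrite Expect_cst expr0n/= mulr0.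
have bMD :=
  bounded_mfunM (bounded_mfunX 3 (bounded_martingale k)) (bounded_D k).
have b2 := bounded_mfunX 2 (bounded_martingale k).
have b4 := bounded_mfunX 4 (bounded_martingale k).
have b1 : bounded_mfun (fun w => M k w ^+ 4 + 4 * (M k w ^+ 3 * D k w)).
  by apply: bounded_mfunD => //; exact: bounded_mfunZ.
have b8 : bounded_mfun (fun w => 8 * C ^+ 2 * M k w ^+ 2 + 3 * C ^+ 4).
  by apply: bounded_mfunD; [exact: bounded_mfunZ|exact: bounded_mfun_cst].
apply: (@le_trans _ _ (\int[P]_w ((M k w ^+ 4 + 4 * (M k w ^+ 3 * D k w)) +
    (8 * C ^+ 2 * M k w ^+ 2 + 3 * C ^+ 4)))).
  apply: le_Expect; [|exact: bounded_mfunD|move=> w].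
    exact/bounded_mfunX/bounded_martingale.
  rewrite MS; set m := M k w; set e := D k w.
  have /andP[e1 e2] : - C <= e <= C by rewrite -ler_norml; exact: hC.
  have eC : e ^+ 2 <= C ^+ 2 by nra.
  have e4C : e ^+ 4 <= C ^+ 4.
    by rewrite !(exprM _ 2 2) lerXn2r ?nnegrE ?sqr_ge0.
  have m2e2 : m ^+ 2 * e ^+ 2 <= m ^+ 2 * C ^+ 2 by rewrite ler_wpM2l ?sqr_ge0.
  (* The sign of this square is the bound on the odd term 4 m e^3. *)
  have me3 : 0 <= (m - e) ^+ 2 * e ^+ 2 by rewrite mulr_ge0 ?sqr_ge0.
  have -> : (m + e) ^+ 4 = (m ^+ 4 + 4 * (m ^+ 3 * e)) +
    (6 * (m ^+ 2 * e ^+ 2) + 4 * m * e ^+ 3 + e ^+ 4) by ring.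
  have E : (m - e) ^+ 2 * e ^+ 2 = m ^+ 2 * e ^+ 2 - 2 * (m * e ^+ 3) + e ^+ 4.
    by ring.
  by rewrite E in me3; lra.
rewrite ExpectD// ExpectD//; last exact: bounded_mfunZ.
rewrite ExpectZ// martingale_orthogonal mulr0 addr0.
rewrite ExpectD; [|exact: bounded_mfunZ|exact: bounded_mfun_cst].
rewrite ExpectZ// Expect_cst.
have := second_moment_le k; rewrite -mulr_natr => m2.
have C20 : 0 <= 8 * C ^+ 2 by rewrite mulr_ge0// sqr_ge0.
have := ler_wpM2l C20 m2.
have C40 : 0 <= C ^+ 4 by rewrite exprn_ge0.
have -> : k.+1%:R = k%:R + 1 :> R by rewrite natr1.
move=> m2'.
have E : 4 * C ^+ 4 * (k%:R + 1) ^+ 2 = 4 * C ^+ 4 * k%:R ^+ 2 +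
  8 * C ^+ 2 * (C ^+ 2 * k%:R) + 4 * C ^+ 4 by ring.
by rewrite E; lra.
Qed.

End martingale.

(** * Degenerate limits *)

Lemma sum_nonneg_cvg_gt0 {R : realType} (u : nat -> R) v :
  (forall n, 0 <= u n) -> u n @[n --> \oo] --> v -> 0 < v ->
  exists K : nat, forall N, v / 2 * (N%:R - K%:R) <= \sum_(0 <= i < N) u i.
Proof.
move=> u0 uv v0; have v20 : 0 < v / 2 by rewrite divr_gt0.
have /cvgrPdist_le/(_ _ v20)[K _ hK] := uv.
have uK i : (K <= i)%N -> v / 2 <= u i.
  by move=> /hK; rewrite /= ler_distlC => /andP[+ _]; lra.
exists K => N; have [NK|/ltnW KN] := leqP N K.
  apply: (@le_trans _ _ 0); last by apply: sumr_ge0.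
  by rewrite pmulr_rle0// subr_le0 ler_nat.
rewrite (big_cat_nat (leq0n K) KN)//= -[leLHS]add0r lerD ?sumr_ge0//.
rewrite -natrB//.
have -> : v / 2 * (N - K)%:R = \sum_(K <= i < N) v / 2.
  by rewrite sumr_const_nat mulr_natr.
by apply: ler_sum_nat => i /andP[Ki _]; exact: uK.
Qed.

Section degenerate_limit.
Context {R : realType} {disp : measure_display} {T : measurableType disp}.
Variable P : probability T R.

(** Test the limit against min (y^2, L), which is bounded, continuous and 0 at
    0.  As y^2 - y^4 / L <= min (y^2, L), its mean at A_N / sqrt N is at least
    a - B / L, which the choice of L makes at least a / 2. *)
Lemma cvg_dirac_second_moment (A : nat -> T -> R) (a B : R) :
  0 < a -> 0 <= B -> (forall N, bounded_mfun (A N)) ->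
  (\forall N \near \oo, a * N%:R <= \int[P]_w (A N w ^+ 2)) ->
  (\forall N \near \oo, \int[P]_w (A N w ^+ 4) <= B * N%:R ^+ 2) ->
  ~ cvg_in_distribution P (fun N w => A N w / Num.sqrt N%:R)
      (\d_(0 : measurableTypeR R)).
Proof.
move=> a0 B0 bA h2 h4 hcvg.
pose L := 2 * (B + 1) / a.
have L0 : 0 < L by rewrite divr_gt0// mulr_gt0// ltr_wpDl.
pose g (y : R) := Num.min (y ^+ 2) L.
have g0 y : 0 <= g y by rewrite /g le_min sqr_ge0 ltW.
have cg : continuous g.
  move=> y; apply: (@continuous_min _ _ (fun y : R => y ^+ 2) (fun=> L)).
    exact: exprn_continuous.
  exact: cst_continuous.
have gL y : `|g y| <= L by rewrite ger0_norm// /g ge_min lexx orbT.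
have bg : bounded_mfun g.
  by split; [exact: continuous_measurable_fun|exists L].
have /(_ g cg (ex_intro _ L gL)) := hcvg.
have -> : (\int[\d_(0%R : measurableTypeR R)]_x (g x)%:E = 0)%E.
  rewrite integral_dirac//; last by apply/measurable_EFinP; case: bg.
  by rewrite diracT mul1e /g expr0n/= min_l// ltW.
move=> lim0.
have bY N : bounded_mfun (fun w => A N w / Num.sqrt N%:R).
  by apply: bounded_mfunM => //; exact: bounded_mfun_cst.
have bgY N : bounded_mfun (fun w => g (A N w / Num.sqrt N%:R)).
  by apply: bounded_mfun_comp bg _; case: (bY N).
suff : ((a / 2)%:E <= 0 :> \bar R)%E by rewrite lee_fin leNgt divr_gt0.
have /cvg_lim <- // := lim0; apply: lime_ge.
  by apply/cvg_ex; eexists; exact: lim0.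
near=> N.
have N1 : (1 <= N)%N by near: N; exists 1%N.
have N0 : 0 < N%:R :> R by rewrite ltr0n.
have N00 : N%:R != 0 :> R by rewrite gt_eqF.
rewrite (bounded_EFin_Expect P (bgY N)) lee_fin.
have bZ : bounded_mfun (fun w => (L * N%:R ^+ 2)^-1 * A N w ^+ 4).
  exact/bounded_mfunZ/bounded_mfunX.
have bZ2 : bounded_mfun (fun w => N%:R^-1 * A N w ^+ 2).
  exact/bounded_mfunZ/bounded_mfunX.
apply: (@le_trans _ _ (\int[P]_w (N%:R^-1 * A N w ^+ 2 -
    (L * N%:R ^+ 2)^-1 * A N w ^+ 4))); last first.
  apply: le_Expect => //; first exact: bounded_mfunB.
  move=> w; set y := A N w / Num.sqrt N%:R.
  have y2 : y ^+ 2 = N%:R^-1 * A N w ^+ 2.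
    by rewrite /y expr_div_n sqr_sqrtr ?ler0n// mulrC.
  have -> : (L * N%:R ^+ 2)^-1 * A N w ^+ 4 = L^-1 * (y ^+ 2) ^+ 2.
    by rewrite y2; field; rewrite N00 gt_eqF.
  rewrite -y2 /g le_min; apply/andP; split.
    by rewrite gerBl// mulr_ge0 ?invr_ge0 ?(ltW L0) ?sqr_ge0.
  rewrite -subr_ge0.
  have -> : L - (y ^+ 2 - L^-1 * (y ^+ 2) ^+ 2) =
      L^-1 * (L - y ^+ 2) ^+ 2 + y ^+ 2 by field; rewrite gt_eqF.
  by rewrite addr_ge0 ?sqr_ge0// mulr_ge0 ?invr_ge0 ?(ltW L0) ?sqr_ge0.
rewrite ExpectB// !ExpectZ; [|exact: bounded_mfunX..].
have H2 : a <= N%:R^-1 * \int[P]_w (A N w ^+ 2).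
  by rewrite ler_pdivlMl// mulrC; near: N.
have H4 : (L * N%:R ^+ 2)^-1 * \int[P]_w (A N w ^+ 4) <= a / 2.
  rewrite ler_pdivrMl; last by rewrite mulr_gt0// exprn_gt0.
  apply: (@le_trans _ _ (B * N%:R ^+ 2)); first by near: N.
  have -> : L * N%:R ^+ 2 * (a / 2) = (B + 1) * N%:R ^+ 2.
    by rewrite /L; field; rewrite gt_eqF.
  by rewrite ler_wpM2r ?sqr_ge0// lerDl.
by lra.
Unshelve. all: by end_near. Qed.

End degenerate_limit.

Section degenerate_walk.
Context {R : realType} {d : nat}.
Local Notation G := (torus R d).
Context {disp : measure_display} {Omega : measurableType disp}.
Variables (P : probability Omega R) (X : nat -> {RV P >-> torus R d}).
Variables nu mu : probability (torus R d) R.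
Hypothesis hmu : normalized_haar mu.
Hypothesis hindep : mutually_independent X.
Hypothesis hlaw : forall i (A : set (torus R d)), measurable A ->
  distribution P (X i) A = nu A.
Variable p : R.
Hypothesis p0 : 0 < p.
Hypothesis hW :
  (\sum_(1 <= k <oo) wasserstein p (convolution_pow nu k) mu < +oo)%E.
Variables f h : torus R d -> R.
Hypothesis hh : almost_holder p h.
Local Notation T := (average nu).
Hypothesis Th : forall x, T h x = h x - f x.

Local Notation M := (martingale X nu h).
Local Notation inc := (increment nu h).
Local Notation V := (conditional_variance nu h).

(** Telescoping: f (S_k) = h (S_k) - T h (S_k) by the Poisson equation. *)
Lemma birkhoff_sum_martingale N w :
  \sum_(1 <= k < N.+1) f (walk X k w) = M N w + (T h 0 - T h (walk X N w)).
Proof.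
elim: N => [|N IHN]; first by rewrite big_geq// /walk big_ord0 subrr add0r.
rewrite big_nat_recr//= IHN.
have fE x : f x = h x - T h x by rewrite Th opprB addrC subrK.
have -> : walk X N.+1 w = walk X N w + X N w by rewrite /walk big_ord_recr.
rewrite martingaleS /increment/= fE.
by ring.
Qed.

(** If v > 0, the mean of V (S_i) is at least v / 2 from some index K on, so the
    second moment of M_N is at least v / 2 (N - K).  The bounded remainder r
    costs constants only: A^2 >= M^2 / 2 - r^2 and A^4 <= 8 M^4 + 8 r^4 for
    A = M + r.  For large N this leaves v / 8 N. *)
Lemma variance_eq0 :
  cvg_in_distribution P
    (fun N w => (\sum_(1 <= k < N.+1) f (walk X k w)) / Num.sqrt N%:R)
    (\d_(0 : measurableTypeR R)) ->
  \int[mu]_x V x = 0.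
Proof.
move=> hcvg; set v := \int[mu]_x V x.
have hV : almost_holder p V by exact: almost_holder_conditional_variance.
have V0 x : 0 <= V x by apply: Rintegral_ge0 => y _; exact: sqr_ge0.
have v0 : 0 <= v by apply: Rintegral_ge0.
apply/eqP; rewrite eq_le v0 andbT leNgt; apply/negP => vgt0.
have [_ [C hC]] := bounded_increment nu p0 hh.
have hT := almost_holder_average nu p0 hh.
have [_ [c hc]] := almost_holder_bounded p0 hT.
have C0 : 0 <= C by exact: le_trans (hC (0, 0)).
have c0 : 0 <= c by exact: le_trans (hc 0).
pose A N w := \sum_(1 <= k < N.+1) f (walk X k w).
pose r N w := T h 0 - T h (walk X N w).
have AE N w : A N w = M N w + r N w by exact: birkhoff_sum_martingale.
have rc N w : `|r N w| <= 2 * c.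
  rewrite (le_trans (ler_normB _ _))// mulr_natl mulr2n.
  by apply: lerD; exact: hc.
have bM N : bounded_mfun (M N) by exact: (bounded_martingale X nu p0 hh).
have br N : bounded_mfun (r N).
  split; last by exists (2 * c).
  apply: measurable_funB => //.
  apply: (measurableT_comp (almost_holder_bounded p0 hT).1).
  exact: measurable_walk.
have bA N : bounded_mfun (A N).
  have -> : A N = fun w => M N w + r N w by apply/funext.
  exact: bounded_mfunD.
have iter0 i : 0 <= iter i T V 0.
  rewrite -(Expect_walk hindep hlaw p0 hh i hV).
  by apply: Rintegral_ge0.
have [K hK] := sum_nonneg_cvg_gt0 iter0 (iter_average_cvg p0 hmu hW 0 hV) vgt0.
pose b := 2 * c.
have b0 : 0 <= b by rewrite mulr_ge0.
have b2 N w : r N w ^+ 2 <= b ^+ 2.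
  by rewrite -[leLHS]real_normK ?num_real// lerXn2r ?nnegrE//; exact: rc.
apply: (@cvg_dirac_second_moment _ _ _ P A (v / 8)
  (32 * C ^+ 4 + 8 * b ^+ 4)) => //.
- by rewrite divr_gt0.
- by rewrite addr_ge0// mulr_ge0// exprn_ge0.
- near=> N.
  have bM2 : bounded_mfun (fun w => 2^-1 * M N w ^+ 2).
    exact/bounded_mfunZ/bounded_mfunX.
  apply: (@le_trans _ _ (\int[P]_w (2^-1 * M N w ^+ 2 - b ^+ 2))); last first.
    apply: le_Expect; [|exact: (bounded_mfunX 2 (bA N))|move=> w].
      by apply: bounded_mfunB => //; exact: bounded_mfun_cst.
    have := b2 N w; rewrite AE; set m := M N w; set e := r N w => eb.
    (* (m + e)^2 - m^2 / 2 + e^2 is half the square of m + 2 e. *)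
    have : 0 <= (m + 2 * e) ^+ 2 by exact: sqr_ge0.
    have -> : (m + 2 * e) ^+ 2 = m ^+ 2 + 4 * m * e + 4 * e ^+ 2 by ring.
    have -> : (m + e) ^+ 2 = m ^+ 2 + 2 * m * e + e ^+ 2 by ring.
    by lra.
  rewrite ExpectB//; last exact: bounded_mfun_cst.
  rewrite Expect_cst ExpectZ; last exact: bounded_mfunX.
  rewrite (second_moment hindep hlaw p0 hh).
  (* The threshold that makes v / 4 (N - K) - b^2 at least v / 8 N. *)
  have := hK N; have : 2 * K%:R + 8 * b ^+ 2 / v <= N%:R.
    by near: N; exact: nbhs_infty_ger.
  rewrite -(ler_pM2l vgt0).
  have -> : v * (2 * K%:R + 8 * b ^+ 2 / v) = 2 * (v * K%:R) + 8 * b ^+ 2.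
    by field; rewrite gt_eqF.
  by rewrite -/v; lra.
- near=> N.
  have N1 : (1 <= N)%N by near: N; exists 1%N.
  have bM4 : bounded_mfun (fun w => 8 * M N w ^+ 4).
    exact/bounded_mfunZ/bounded_mfunX.
  apply: (@le_trans _ _ (\int[P]_w (8 * M N w ^+ 4 + 8 * b ^+ 4))).
    apply: le_Expect; [exact: (bounded_mfunX 4 (bA N))| |move=> w].
      by apply: bounded_mfunD => //; exact: bounded_mfun_cst.
    have := b2 N w; rewrite AE; set m := M N w; set e := r N w => eb.
    have e4 : e ^+ 4 <= b ^+ 4.
      by rewrite !(exprM _ 2 2) lerXn2r ?nnegrE ?sqr_ge0.
    have s2 : (m + e) ^+ 2 <= 2 * m ^+ 2 + 2 * e ^+ 2.
      have : 0 <= (m - e) ^+ 2 by exact: sqr_ge0.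
      have -> : (m - e) ^+ 2 = m ^+ 2 - 2 * m * e + e ^+ 2 by ring.
      have -> : (m + e) ^+ 2 = m ^+ 2 + 2 * m * e + e ^+ 2 by ring.
      by lra.
    have s4 : ((m + e) ^+ 2) ^+ 2 <= (2 * m ^+ 2 + 2 * e ^+ 2) ^+ 2.
      apply: lerXn2r => //; rewrite nnegrE ?sqr_ge0//.
      by apply: addr_ge0; rewrite mulr_ge0 ?sqr_ge0.
    have : 0 <= (m ^+ 2 - e ^+ 2) ^+ 2 by exact: sqr_ge0.
    move: s4; rewrite -exprM.
    have -> : (2 * m ^+ 2 + 2 * e ^+ 2) ^+ 2 =
      8 * m ^+ 4 + 8 * e ^+ 4 - 4 * (m ^+ 2 - e ^+ 2) ^+ 2 by ring.
    have -> : (2 * 2)%N = 4%N by [].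
    by lra.
  rewrite ExpectD//; last exact: bounded_mfun_cst.
  rewrite Expect_cst ExpectZ; last exact: bounded_mfunX.
  have := fourth_moment_le hindep hlaw p0 hh hC N.
  have N21 : 1 <= N%:R ^+ 2 :> R by rewrite exprn_ege1// ler1n.
  have : 8 * b ^+ 4 <= 8 * b ^+ 4 * N%:R ^+ 2.
    by rewrite ler_peMr// mulr_ge0// exprn_ge0.
  by rewrite mulrDl; lra.
Unshelve. all: by end_near. Qed.

(** The vanishing double integral of the squared increment is integrated over x
    first: some y0 makes the inner integral vanish, and this inner integrand
    is continuous in x. *)
Lemma zero_variance_translation : \int[mu]_x V x = 0 ->
  exists y0, forall x, h (x + y0) = T h x.
Proof.
move=> IV0.
have binc2 := bounded_mfunX 2 (bounded_increment nu p0 hh).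
have [y0 hy0] : exists y0, \int[mu]_x (inc (x, y0) ^+ 2) = 0.
  apply: (@probability_ae_ex _ _ _ nu); apply: Expect_eq0_ae.
  - exact: (bounded_mfun_Expect2 mu nu binc2).
  - by move=> y; apply: Rintegral_ge0 => x _; exact: sqr_ge0.
  - by rewrite -(Expect_prod2 mu nu binc2) (Expect_prod1 mu nu binc2).
exists y0 => x.
have hinc : almost_holder p (fun z => inc (z, y0) * inc (z, y0)).
  have hi : almost_holder p (fun z => inc (z, y0)).
    apply: (almost_holderB p0); last exact: almost_holder_average.
    rewrite /= (_ : (fun z => h (z + y0)) = fun z => h (y0 + z)).
      exact: almost_holder_translate.
    by apply/funext => z; rewrite addrC.
  exact: almost_holderM.
have := haar_Expect_eq0 hmu (almost_holder_continuous p0 hinc)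
  (fun z => sqr_ge0 (inc (z, y0))) hy0 x.
by move=> /eqP; rewrite mulf_eq0 orbb subr_eq0 => /eqP.
Qed.

End degenerate_walk.

Theorem proposition2 (R : realType) (d : nat) (hd : (1 <= d)%N)
  (mu : probability (torus R d) R) (hmu : normalized_haar mu)
  (nu : probability (torus R d) R)
  (disp : measure_display) (T : measurableType disp) (P : probability T R)
  (* [X i] is the (i+1)-st step of the walk *)
  (X : nat -> {RV P >-> torus R d})
  (hindep : mutually_independent X)
  (hlaw : forall i (A : set (torus R d)), measurable A ->
    distribution P (X i) A = nu A)
  (p : R) (hp0 : 0 < p) (hp1 : p <= 1)
  (hW : (\sum_(1 <= k <oo) wasserstein p (convolution_pow nu k) mu < +oo)%E)
  (f : torus R d -> R) (hf : holder p f)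
  (hf0 : (\int[mu]_x (f x)%:E = 0)%E)
  (sigma : R) (hsigma : 0 <= sigma)
  (hclt : cvg_in_distribution P
    (fun N w => (\sum_(1 <= k < N.+1) f (walk X k w)) / Num.sqrt N%:R)
    (centered_normal sigma))
  (hlil : {ae P, forall w,
    limn_esup (fun N => ((\sum_(1 <= k < N.+1) f (walk X k w)) /
      Num.sqrt (2 * N%:R * ln (ln N%:R)))%:E) = sigma%:E}) :
  sigma = 0 <-> (forall x, f x = 0).
Proof.
split=> [sigma0 x|f0]; last first.
  have [w] := probability_ae_ex hlil.
  rewrite (_ : (fun N => _) = fun=> 0%E); last first.
    by apply/funext => N; rewrite big1 ?mul0r.
  have [_ ->] := @cvg_limn_einf_sup R (fun=> 0%E) 0%E (cvg_cst _).
  by case.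
have f0 : \int[mu]_x f x = 0 by rewrite /Rintegral hf0.
have [b fb cb] := summable_iter_average hp0 hmu hW hf f0.
have [h [hh Th [r r0 hr]]] :=
  poisson_equation hp0 (holder_almost_holder hf) fb cb.
have hclt0 : cvg_in_distribution P
    (fun N w => (\sum_(1 <= k < N.+1) f (walk X k w)) / Num.sqrt N%:R)
    (\d_(0 : measurableTypeR R)).
  by move: hclt; rewrite /centered_normal sigma0 eqxx.
have V0 := variance_eq0 hmu hindep hlaw hp0 hW hh Th hclt0.
have [y0 hy0] := zero_variance_translation hmu hp0 hh V0.
have h0 := deterministic_average_eq0 hy0 r0 hr.
by have := Th x; rewrite -hy0 !h0 sub0r => /esym/eqP; rewrite oppr_eq0 => /eqP.
Qed.
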